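(* Let $u$ be a smooth solution on $B_1\subset\mathbb{R}^n$ of $$\sum_{i=1}^n\arctan\lambda_i=\Theta(x,u,Du)\in\left(-n\tfrac{\pi}{2},n\tfrac{\pi}{2}\right),$$ where $\lambda_1,\dots,\lambda_n$ are the eigenvalues of the Hessian $D^2u$, with $|\Theta|\ge (n-2)\frac{\pi}{2}$. Suppose that $\Theta(x,z,p)$ satisfies the following conditions: (a) $\Theta(x,z,p)$ is uniformly $C^2$ in $x$, i.e., $|\Theta_{xx}|\le\|\Theta_{xx}\|_{L^\infty(\Gamma_1)}$ independently of $u$ and $Du$, and $$|D_x\Theta(x,z,p)|\le C\left(\Theta(x,z,p)-\tfrac{(n-2)\pi}{2}\right)^{1/2};$$ (b) $\Theta_z$ is non-negative: $$D_z\Theta(x,z,p)=\Theta_z(x,z,p)\ge 0;$$ (c) $\Theta$ has superlinear decay $o(1/|p|)$ as $p\to\infty$ and $\Theta\to(n-2)\pi/2$; more quantitatively, $$|p|\,|D_p\Theta(x,z,p)|\le C\left(\Theta(x,z,p)-\tfrac{(n-2)\pi}{2}\right).$$ Then $u$ satisfies the estimate $$|Du(0)|\le C(n,\|\Theta_{xx}\|_{L^\infty(\Gamma_1)})\left(1+(\operatorname{osc}_{B_1}u)^2\right).$$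
   Context: $B_1$ is the ball of radius $1$ centered at the origin, and $\operatorname{osc}_{B_1}u$ is the oscillation of $u$ in $B_1$. $\Gamma_1=B_1\times u(B_1)\times Du(B_1)\subset B_1\times\mathbb{R}\times\mathbb{R}^n$. In the partial derivatives of $\Theta(x,z,p)$ the variables $x\in\mathbb{R}^n$, $z\in\mathbb{R}$, $p\in\mathbb{R}^n$ are treated as independent of each other. $\Theta(x,u,Du)$ means $\Theta$ evaluated at $(x,z,p)=(x,u(x),Du(x))$. The letter $C$ in (a) and (c) denotes a constant, and $C(n,\|\Theta_{xx}\|_{L^\infty(\Gamma_1)})$ denotes a constant depending on $n$ and $\|\Theta_{xx}\|_{L^\infty(\Gamma_1)}$. *)

(* Defs.v *)
From HB Require Import structures.
From mathcomp Require Import all_boot all_order all_algebra.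
From mathcomp Require Import all_classical all_reals all_analysis.

Set Implicit Arguments.
Unset Strict Implicit.
Unset Printing Implicit Defensive.

Import Order.TTheory GRing.Theory Num.Theory.
Import numFieldNormedType.Exports.

Local Open Scope classical_set_scope.
Local Open Scope ring_scope.

(* The library norm `|x| on matrices is the sup norm; this is the Euclidean
   norm of a vector and the Frobenius norm of a matrix. *)
Definition l2norm (R : realType) (m n : nat) (A : 'M[R]_(m, n)) : R :=
  Num.sqrt (\sum_(i < m) \sum_(j < n) A i j ^+ 2).

Definition unit_ball (R : realType) (n : nat) : set 'rV[R]_n :=
  [set x | l2norm x < 1].

Arguments unit_ball {R} n _.

Definition partial (R : realType) (n : nat) (i : 'I_n) (f : 'rV[R]_n -> R) :
    'rV[R]_n -> R :=
  fun x => 'D_(delta_mx 0 i) f x.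

(* partials [:: i1; ...; ik] f = d_i1 (... (d_ik f)) *)
Definition partials (R : realType) (n : nat) (s : seq 'I_n)
    (f : 'rV[R]_n -> R) : 'rV[R]_n -> R :=
  foldr (@partial R n) f s.

Definition grad (R : realType) (n : nat) (f : 'rV[R]_n -> R) (x : 'rV[R]_n) :
    'rV[R]_n :=
  \row_i partial i f x.

Definition hessian (R : realType) (n : nat) (f : 'rV[R]_n -> R)
    (x : 'rV[R]_n) : 'M[R]_n :=
  \matrix_(i, j) partials [:: i; j] f x.

(* Intended for open A: differentiability (in the Frechet sense) of the
   partials of order < k also guarantees that the limits defining the partials
   of order <= k exist. *)
Definition Ck_on (R : realType) (n k : nat) (A : set 'rV[R]_n)
    (f : 'rV[R]_n -> R) : Prop :=
  forall (s : seq 'I_n) (x : 'rV[R]_n), A x ->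
    ((size s < k)%N -> differentiable (partials s f) x) /\
    ((size s <= k)%N -> {for x, continuous (partials s f)}).

Definition smooth_on (R : realType) (n : nat) (A : set 'rV[R]_n)
    (f : 'rV[R]_n -> R) : Prop :=
  forall k : nat, Ck_on k A f.

(* lambda lists the eigenvalues of A with multiplicity, in any order. *)
Definition eigenvalues (R : realType) (n : nat) (A : 'M[R]_n)
    (lambda : 'I_n -> R) : Prop :=
  char_poly A = \prod_(i < n) ('X - (lambda i)%:P).

(* Possibly +oo: u is only controlled on the open ball. *)
Definition osc (R : realType) (n : nat) (A : set 'rV[R]_n)
    (u : 'rV[R]_n -> R) : \bar R :=
  (ereal_sup [set (u x)%:E | x in A] - ereal_inf [set (u x)%:E | x in A])%E.

Definition Gamma1 (R : realType) (n : nat) (u : 'rV[R]_n -> R) :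
    set ('rV[R]_n * R * 'rV[R]_n) :=
  (unit_ball n `*` (u @` unit_ball n)) `*` (grad u @` unit_ball n).

Definition D_x (R : realType) (n : nat)
    (Theta : 'rV[R]_n -> R -> 'rV[R]_n -> R) x z p : 'rV[R]_n :=
  grad (fun y => Theta y z p) x.

Definition D_z (R : realType) (n : nat)
    (Theta : 'rV[R]_n -> R -> 'rV[R]_n -> R) x z p : R :=
  derive1 (fun t : R => Theta x t p) z.

Definition D_p (R : realType) (n : nat)
    (Theta : 'rV[R]_n -> R -> 'rV[R]_n -> R) x z p : 'rV[R]_n :=
  grad (fun q => Theta x z q) p.

Definition D_xx (R : realType) (n : nat)
    (Theta : 'rV[R]_n -> R -> 'rV[R]_n -> R) x z p : 'M[R]_n :=
  hessian (fun y => Theta y z p) x.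

(* The L^oo norm over Gamma1 is a pointwise supremum rather than an essential
   one: Gamma1 can be Lebesgue-null, e.g. when grad u has a thin image. *)
Definition Theta_xx_norm (R : realType) (n : nat)
    (Theta : 'rV[R]_n -> R -> 'rV[R]_n -> R) (u : 'rV[R]_n -> R) : \bar R :=
  ereal_sup [set (l2norm (D_xx Theta w.1.1 w.1.2 w.2))%:E | w in Gamma1 u].

Definition critical_phase (R : realType) (n : nat) : R :=
  (n%:R - 2) * (pi / 2).

(* Main.v *)
(* Bernstein's method, maximising eta |Du| + f(u) over the ball of radius 1/2,
   where eta = 1 - 4|x|^2, f(s) = 8 n s + s^2 / (2 m) with s = u - inf u, and
   m = 1 + osc u, so that 8 n <= f' <= 9 n and f'' = 1/m.  At an interior
   maximum put w = |Du| and xi = Du / w; since <xi, Du> <= |Du|, the function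
   eta <xi, Du> + f(u) has a maximum there too and its second derivatives only
   involve the linear quantity <xi, Du>.  In an orthonormal eigenframe of D^2 u,
   choose i with xi_i^2 >= 1/n.  The first order condition makes lambda_i
   negative of size comparable to w / eta; the phase being critical or
   supercritical, every other eigenvalue is at least |lambda_i|, and
   Theta - (n-2) pi/2 <= 1/|lambda_i|.  Differentiating the equation along xi
   gives sum_j (D_xi D^2 u)_jj / (1 + lambda_j^2) = D_xi Theta, where (a) and (c)
   make D_xi Theta of order |lambda_i|^(-1/2) from below while (b) makes the
   Theta_z term nonnegative.  Weighting the second order conditions by
   1 / (1 + lambda_j^2), the f'' term beats all others unless
   eta w <= C m^2. *)

Require Import Defs.
From HB Require Import structures.
From mathcomp Require Import all_boot all_order all_algebra.
From mathcomp Require Import fingroup perm.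
From mathcomp Require Import all_classical all_reals all_analysis.
From mathcomp Require Import complex ring lra.

Set Implicit Arguments.
Unset Strict Implicit.
Unset Printing Implicit Defensive.

Import Order.TTheory GRing.Theory Num.Theory.
Import numFieldNormedType.Exports.

Local Open Scope classical_set_scope.
Local Open Scope ring_scope.

(** * Diagonalization of symmetric matrices *)

Lemma row_sqr (R : comNzRingType) n (v : 'rV[R]_n) :
  (v *m v^T) 0 0 = \sum_i v 0 i ^+ 2.
Proof. by rewrite mxE; apply: eq_bigr => i _; rewrite mxE expr2. Qed.

(** Take the reflection in the hyperplane orthogonal to [d = e - v], where [e] is the first basis
    vector: as [e] and [v] have the same length, it swaps them. For [v = e] this degenerates and the
    identity serves. *)
Lemma householder (R : rcfType) n (v : 'rV[R]_n.+1) : v *m v^T = 1%:M ->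
  exists H : 'M[R]_n.+1,
    [/\ H^T = H, H *m H = 1%:M & delta_mx 0 0 *m H = v].
Proof.
move=> v1; set e : 'rV[R]_n.+1 := delta_mx 0 0.
have e1 : e *m e^T = 1%:M.
  apply/matrixP=> i j; rewrite !ord1 row_sqr (bigD1 0) //= big1 => [|k k0].
    by rewrite /e !mxE !eqxx expr1n addr0.
  by rewrite /e mxE (negbTE k0) andbF expr0n.
have [->|ev] := eqVneq v e.
  by exists 1%:M; rewrite trmx1 !mulmx1.
pose d := e - v; pose s := (d *m d^T) 0 0.
have s0 : s != 0.
  rewrite /s row_sqr psumr_neq0; last by move=> i _; exact: sqr_ge0.
  apply: contraR ev => /hasPn dv; rewrite eq_sym -subr_eq0; apply/eqP/rowP => i.
  have := dv i (mem_index_enum i); rewrite /= lt_def sqr_ge0 andbT negbK sqrf_eq0.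
  by rewrite !mxE => /eqP.
have sE : d *m d^T = s%:M by apply/matrixP=> i j; rewrite !ord1 [RHS]mxE eqxx.
(* Since |e| = |v| = 1, |e - v|^2 = 2 - 2 <e, v> = 2 <e, e - v>. *)
have es : e *m d^T = (s / 2)%:M.
  have vTe : v *m e^T = e *m v^T.
    by apply/matrixP=> i j; rewrite !ord1 -[e *m v^T]trmxK trmx_mul trmxK [RHS]mxE.
  apply: (@scalerI _ _ 2%:R); first by rewrite pnatr_eq0.
  rewrite scale_scalar_mx mulrCA divff ?pnatr_eq0 // mulr1 -sE /d.
  rewrite linearB /= mulmxBl !mulmxBr e1 v1 vTe -[2%:R]/(1 + 1) scalerDl scale1r.
  by rewrite opprB addrACA addrA.
exists (1%:M - (2 / s) *: (d^T *m d)); split.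
- by rewrite linearB linearZ /= trmx1 trmx_mul trmxK.
- have KK : (d^T *m d) *m (d^T *m d) = s *: (d^T *m d).
    by rewrite mulmxA -(mulmxA d^T) sE mul_mx_scalar scalemxAl.
  move: (d^T *m d) KK => K KK.
  rewrite mulmxBl mul1mx mulmxBr mulmx1 -scalemxAl -scalemxAr KK !scalerA.
  have -> : 2 / s * (2 / s) * s = 2 * (2 / s) by field.
  by apply/matrixP => i j; rewrite !mxE; ring.
- rewrite mulmxBr mulmx1 -scalemxAr mulmxA es mul_scalar_mx scalerA.
  rewrite mulrA divfK // divff ?pnatr_eq0 // scale1r /d opprB addrC subrK //.
Qed.

Lemma char_poly_conj (R : comNzRingType) n (Q P A : 'M[R]_n) :
  Q *m P = 1%:M -> char_poly (Q *m A *m P) = char_poly A.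
Proof.
move=> QP; rewrite /char_poly.
have QPX : map_mx polyC Q *m map_mx polyC P = 1%:M.
  by rewrite -map_mxM QP map_mx1.
have -> : char_poly_mx (Q *m A *m P) =
    map_mx polyC Q *m char_poly_mx A *m map_mx polyC P.
  rewrite /char_poly_mx !map_mxM mulmxBr mulmxBl; congr (_ - _).
  by rewrite mul_mx_scalar -scalemxAl QPX scalemx1.
by rewrite !det_mulmx mulrAC -det_mulmx QPX det1 mul1r.
Qed.

(** Induction on the dimension. A Householder reflection carries a unit eigenvector for [lam 0] to
    the first basis vector; symmetry then clears the rest of the first row and column, and
    cancelling the factor ['X - lam 0] gives the characteristic polynomial of the remaining block.
    The prescribed order of [lam] is kept. *)
Lemma symmetric_diagonalization (R : rcfType) n (A : 'M[R]_n) (lam : 'I_n -> R) :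
  A^T = A -> char_poly A = \prod_(i < n) ('X - (lam i)%:P) ->
  exists Q : 'M[R]_n,
    Q *m Q^T = 1%:M /\ Q *m A *m Q^T = diag_mx (\row_i lam i).
Proof.
elim: n => [|n IHn] in A lam *.
  by exists 1%:M; split; apply/matrixP => -[].
move=> AT charA.
have : eigenvalue A (lam 0).
  rewrite eigenvalue_root_char charA big_ord_recl rootM.
  by rewrite root_XsubC eqxx.
case/eigenvalueP => v0 v0A v0_neq0.
pose s := (v0 *m v0^T) 0 0.
have s_gt0 : 0 < s.
  rewrite lt_def /s row_sqr sumr_ge0 ?andbT => [|i _]; last exact: sqr_ge0.
  apply: contra v0_neq0; rewrite psumr_eq0 => [/allP v0E|i _]; last exact: sqr_ge0.
  apply/eqP/rowP => i; have := v0E i (mem_index_enum i).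
  by rewrite sqrf_eq0 mxE => /eqP.
pose v := (Num.sqrt s)^-1 *: v0.
have vA : v *m A = lam 0 *: v by rewrite -scalemxAl v0A !scalerA mulrC.
have v1 : v *m v^T = 1%:M.
  rewrite /v linearZ /= -scalemxAl -scalemxAr scalerA -invfM -expr2 sqr_sqrtr ?ltW //.
  apply/matrixP => i j; rewrite !ord1 [LHS]mxE [RHS]mxE eqxx.
  by rewrite -/s mulVf // gt_eqF.
have [H [HT HH Hv]] := householder v1.
have [B BD] : exists B, B = H *m A *m H by eexists.
have BT : B^T = B by rewrite BD !trmx_mul AT HT mulmxA.
have B0 : delta_mx 0 0 *m B = lam 0 *: (delta_mx 0 0 : 'rV[R]_n.+1).
  by rewrite BD !mulmxA Hv vA -scalemxAl -Hv -mulmxA HH mulmx1.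
have B0j j : B 0 j = lam 0 *+ (j == 0).
  have /rowP/(_ j) := B0; rewrite -rowE !mxE => ->.
  by rewrite eqxx /= mulr_natr.
pose B' : 'M[R]_n := drsubmx (B : 'M[R]_(1 + n)).
have BE : B = block_mx ((lam 0)%:M : 'M[R]_1) 0 0 B'.
  rewrite -[LHS](@submxK R 1 n 1 n); congr (@block_mx R 1 n 1 n _ _ _ _).
  - by apply/matrixP => i j; rewrite !mxE !ord1 !lshift0 B0j.
  - by apply/matrixP => i j; rewrite !mxE !ord1 !lshift0 B0j.
  - by apply/matrixP => i j; rewrite !mxE !ord1 !lshift0 -BT mxE B0j.
have B'T : B'^T = B' by rewrite /B' trmx_drsub BT.
have charB' : char_poly B' = \prod_(i < n) ('X - (lam (lift 0 i))%:P).
  have := char_poly_conj A HH; rewrite -BD charA BE.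
  have -> : char_poly (block_mx ((lam 0)%:M : 'M[R]_1) 0 0 B' : 'M[R]_n.+1) =
      ('X - (lam 0)%:P) * char_poly B'.
    transitivity (\det (char_poly_mx (block_mx ((lam 0)%:M : 'M[R]_1) 0 0 B'))) => //.
    rewrite char_block_diag_mx det_ublock; congr (_ * _).
    by rewrite /char_poly_mx map_scalar_mx /= -raddfB /= det_scalar1.
  rewrite big_ord_recl => /esym.
  have nz : 'X - (lam 0)%:P != 0 by rewrite polyXsubC_eq0.
  by move=> /(mulfI nz).
have [Q' [Q'1 Q'B]] := IHn _ _ B'T charB'.
pose Q := block_mx (1%:M : 'M[R]_1) 0 0 Q'.
have QT : Q^T = block_mx (1%:M : 'M[R]_1) 0 0 Q'^T.
  by rewrite tr_block_mx trmx1 !trmx0.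
have QQ : Q *m Q^T = 1%:M.
  rewrite QT mulmx_block !(mulmx0, mul0mx, addr0, add0r) mulmx1 Q'1.
  by rewrite -scalar_mx_block.
exists (Q *m H); rewrite trmx_mul HT; split.
  by rewrite mulmxA -[Q *m H *m H]mulmxA HH mulmx1.
have -> : Q *m H *m A *m (H *m Q^T) = Q *m B *m Q^T by rewrite BD !mulmxA.
have -> : Q *m B *m Q^T =
    block_mx ((lam 0)%:M : 'M[R]_1) 0 0 (diag_mx (\row_i lam (lift 0 i))).
  rewrite BE QT -Q'B; transitivity (Q *m block_mx ((lam 0)%:M : 'M[R]_1) 0 0 B' *m
    block_mx (1%:M : 'M[R]_1) 0 0 Q'^T) => //.
  by rewrite /Q !mulmx_block !(mulmx0, mul0mx, addr0, add0r, mulmx1, mul1mx).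
have -> : \row_i lam i = row_mx (lam 0)%:M (\row_i lam (lift 0 i)) :> 'rV[R]_(1 + n).
  apply/rowP => i; rewrite mxE; case: (unliftP 0 i) => [j|] ->.
    by rewrite -rshift1 row_mxEr mxE rshift1.
  by rewrite -[in RHS](lshift0 n 0) row_mxEl mxE eqxx lshift0.
have lam00 : diag_mx ((lam 0)%:M : 'rV[R]_1) = (lam 0)%:M.
  by apply/matrixP => i j; rewrite !ord1 !mxE eqxx.
by have := diag_mx_row ((lam 0)%:M : 'rV[R]_1) (\row_i lam (lift 0 i)); rewrite lam00 => ->.
Qed.

(** * Derivative of the sum of the arctangents of the eigenvalues *)

(** This rule and the next ones concern explicit functions [fun y => ...] and name the derivative
    values, so that long derivatives can be assembled as proof terms. *)
Lemma is_derive_mul (R : realType) (V : normedModType R) (f g : V -> R) (x v : V)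
    (df dg : R) :
  is_derive x v f df -> is_derive x v g dg ->
  is_derive x v (fun y => f y * g y) (df * g x + f x * dg).
Proof.
move=> Df Dg; apply: is_derive_eq (is_deriveM Df Dg) _.
by rewrite /GRing.scale /= addrC [g x * df]mulrC.
Qed.

Lemma is_derive_add (R : realType) (V W : normedModType R) (f g : V -> W)
    (x v : V) (df dg : W) :
  is_derive x v f df -> is_derive x v g dg ->
  is_derive x v (fun y => f y + g y) (df + dg).
Proof. exact: is_deriveD. Qed.

Lemma is_derive_opp (R : realType) (V W : normedModType R) (f : V -> W)
    (x v : V) (df : W) :
  is_derive x v f df -> is_derive x v (fun y => - f y) (- df).
Proof. exact: is_deriveN. Qed.

Lemma is_derive_const (R : realType) (V W : normedModType R) (c : W) (x v : V) :
  is_derive x v (fun=> c) 0.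
Proof. exact: is_derive_cst. Qed.

Lemma is_derive_bigsum (R : realType) (V W : normedModType R) (I : Type)
    (r : seq I) (P : pred I) (f : I -> V -> W) (x v : V) (df : I -> W) :
  (forall i, is_derive x v (f i) (df i)) ->
  is_derive x v (fun y => \sum_(i <- r | P i) f i y) (\sum_(i <- r | P i) df i).
Proof.
move=> Df; rewrite (_ : (fun y => _) = \sum_(i <- r | P i) f i); last first.
  by apply/funext => y; rewrite fct_sumE.
by elim/big_ind2 : _ => // [|] *; [exact: is_derive_cst|exact: is_deriveD].
Qed.

Lemma is_derive_unique (R : realType) (V W : normedModType R) (f : V -> W)
    (x v : V) (d d' : W) :
  is_derive x v f d -> is_derive x v f d' -> d = d'.
Proof. by move=> [_ <-] [_ <-]. Qed.

(** * Complex-valued functions of a real variable, and the phase as an argument *)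

Section ComplexDerivative.
Import complex.
Local Open Scope complex_scope.

Definition is_cderive (R : realType) (x : R) (f : R -> R[i]) (d : R[i]) :=
  is_derive x 1 (fun t => Re (f t)) (Re d) /\
  is_derive x 1 (fun t => Im (f t)) (Im d).

Lemma is_cderive_eq (R : realType) (x : R) (f : R -> R[i]) (d d' : R[i]) :
  is_cderive x f d -> d = d' -> is_cderive x f d'.
Proof. by move=> ? <-. Qed.

Lemma is_cderive_const (R : realType) (x : R) (c : R[i]) :
  is_cderive x (fun=> c) 0.
Proof. by split; exact: is_derive_cst. Qed.

Lemma is_cderive_add (R : realType) (x : R) (f g : R -> R[i]) (df dg : R[i]) :
  is_cderive x f df -> is_cderive x g dg ->
  is_cderive x (fun t => f t + g t) (df + dg).
Proof.
move=> [fr fi] [gr gi]; split; rewrite raddfD.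
  by under eq_fun do rewrite raddfD; exact: is_derive_add.
by under eq_fun do rewrite raddfD; exact: is_derive_add.
Qed.

Lemma ReM (R : realType) (z w : R[i]) : Re (z * w) = Re z * Re w - Im z * Im w.
Proof. by case: z w => [a b] [c d]. Qed.

Lemma ImM (R : realType) (z w : R[i]) : Im (z * w) = Re z * Im w + Im z * Re w.
Proof. by case: z w => [a b] [c d]. Qed.

Lemma is_cderive_mul (R : realType) (x : R) (f g : R -> R[i]) (df dg : R[i]) :
  is_cderive x f df -> is_cderive x g dg ->
  is_cderive x (fun t => f t * g t) (df * g x + f x * dg).
Proof.
move=> [fr fi] [gr gi]; split; rewrite raddfD.
  under eq_fun do rewrite ReM.
  apply: is_derive_eq (is_derive_add (is_derive_mul fr gr)
    (is_derive_opp (is_derive_mul fi gi))) _.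
  by rewrite /= !ReM; ring.
under eq_fun do rewrite ImM.
apply: is_derive_eq (is_derive_add (is_derive_mul fr gi) (is_derive_mul fi gr)) _.
by rewrite /= !ImM; ring.
Qed.

Lemma is_cderive_sum (R : realType) (x : R) (I : Type) (r : seq I)
    (f : I -> R -> R[i]) (df : I -> R[i]) :
  (forall i, is_cderive x (f i) (df i)) ->
  is_cderive x (fun t => \sum_(i <- r) f i t) (\sum_(i <- r) df i).
Proof.
move=> Df; elim: r => [|i r IH].
  by rewrite big_nil; under eq_fun do rewrite big_nil; exact: is_cderive_const.
by rewrite big_cons; under eq_fun do rewrite big_cons; exact: is_cderive_add.
Qed.

Lemma is_cderive_prod (R : realType) (x : R) n
    (f : 'I_n -> R -> R[i]) (df : 'I_n -> R[i]) :
  (forall i, is_cderive x (f i) (df i)) ->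
  is_cderive x (fun t => \prod_i f i t)
    (\sum_i df i * \prod_(j | j != i) f j x).
Proof.
elim: n => [|n IH] in f df *; move=> Df.
  rewrite big_ord0; under eq_fun do rewrite big_ord0; exact: is_cderive_const.
under eq_fun do rewrite big_ord_recl.
apply: is_cderive_eq (is_cderive_mul (Df ord0) (IH _ _ (fun i => Df (lift ord0 i)))) _.
rewrite [in RHS]big_ord_recl; congr (_ * _ + _).
  rewrite [RHS]big_mkcond big_ord_recl eqxx /= mul1r.
  by apply: eq_bigr.
rewrite big_distrr; apply: eq_bigr => i _ /=.
rewrite [in RHS]big_mkcond big_ord_recl /= mulrCA; congr (_ * (_ * _)).
rewrite [LHS]big_mkcond; apply: eq_bigr => j _.
by rewrite (inj_eq lift_inj).
Qed.

(* A non-identity permutation moves at least two points, so each derivative of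
   its term in the Leibniz formula keeps a vanishing off-diagonal factor. *)
Lemma is_cderive_det_diag (R : realType) (x : R) n (M : R -> 'M[R[i]]_n)
    (N : 'M[R[i]]_n) :
  (forall i j, is_cderive x (fun t => M t i j) (N i j)) ->
  (forall i j, i != j -> M x i j = 0) ->
  is_cderive x (fun t => \det (M t))
    (\sum_i N i i * \prod_(j | j != i) M x j j).
Proof.
move=> DM diagM; rewrite /determinant.
have Ds (s : 'S_n) := is_cderive_mul (is_cderive_const x ((-1) ^+ s))
  (is_cderive_prod (fun i => DM i (s i))).
apply: is_cderive_eq (is_cderive_sum _ Ds) _.
rewrite (bigD1 1%g) //= [X in _ + X = _]big1 => [|s s1].
  rewrite addr0 odd_perm1 mul0r add0r mul1r; apply: eq_bigr => i _.
  by rewrite perm1; congr (_ * _); apply: eq_bigr => j _; rewrite perm1.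
rewrite mul0r add0r big1 ?mulr0 // => i _.
have [j ji sj] : exists2 j, j != i & s j != j.
  have [k sk] : exists k, s k != k.
    apply/existsP; apply: contraR s1; rewrite negb_exists => /forallP sid.
    by apply/eqP/permP => k; rewrite perm1; apply/eqP; have := sid k; rewrite negbK.
  have [ki|] := eqVneq k i; last by exists k.
  exists (s k); first by rewrite -ki.
  by rewrite (inj_eq perm_inj).
by rewrite (bigD1 j ji) /= diagM ?mul0r ?mulr0 // eq_sym.
Qed.
Definition cexpi (R : realType) (s : R) : R[i] := cos s +i* sin s.

Lemma cexpiD (R : realType) (s t : R) : cexpi (s + t) = cexpi s * cexpi t.
Proof.
apply/eqP; rewrite eq_complex ReM ImM /= sinD cosD eqxx /=.
by rewrite [eqbRHS]addrC.
Qed.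

Lemma cexpi_atan (R : realType) (l : R) :
  1 +i* l = (Num.sqrt (1 + l ^+ 2))%:C * cexpi (atan l).
Proof.
have l1 : 0 < 1 + l ^+ 2 by rewrite ltr_pwDl // sqr_ge0.
have s0 : Num.sqrt (1 + l ^+ 2) != 0 by rewrite gt_eqF // sqrtr_gt0.
have sinE : sin (atan l) = l * cos (atan l).
  rewrite -{2}[l]atanK /tan divfK // cos_atan invr_eq0 //.
apply/eqP; rewrite eq_complex ReM ImM /= !mul0r subr0 addr0 sinE cos_atan.
by rewrite divff // mulrCA divff // mulr1 !eqxx.
Qed.

(** Exhibits the phase as an argument of a product that will be a determinant. A determinant is
    polynomial in the matrix entries, so its derivative never requires the individual eigenvalues to
    be differentiable. *)
Lemma prod_cexpi_atan (R : realType) n (l : 'I_n -> R) :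
  \prod_i (1 +i* l i) =
  (\prod_i Num.sqrt (1 + l i ^+ 2))%:C * cexpi (\sum_i atan (l i)).
Proof.
elim: n => [|n IH] in l *.
  rewrite !big_ord0 /cexpi cos0 sin0; apply/eqP; rewrite eq_complex ReM ImM /=.
  by rewrite !mulr1 !mulr0 subr0 addr0 !eqxx.
by rewrite !big_ord_recl IH cexpi_atan rmorphM cexpiD mulrACA.
Qed.

Lemma is_cderive_cexpi (R : realType) (x : R) (F : R -> R) (dF : R) :
  is_derive x 1 F dF ->
  is_cderive x (fun t => cexpi (F t)) ((0 +i* dF) * cexpi (F x)).
Proof.
move=> DF; split => /=.
  rewrite mul0r sub0r; apply: is_derive_eq (is_derive1_comp (f := cos) _ _) _.
  by rewrite mulrC mulrN.
rewrite mul0r add0r; apply: is_derive_eq (is_derive1_comp (f := sin) _ _) _.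
by rewrite mulrC.
Qed.

Lemma det_char_poly (K : fieldType) n (A : 'M[K]_n) a :
  \det (a%:M - A) = (char_poly A).[a].
Proof.
rewrite /char_poly -horner_evalE -det_map_mx; congr (\det _).
by apply/matrixP => i j; rewrite !mxE /= horner_evalE !(hornerE, hornerMn).
Qed.

(* With [M t = iI - Q A(t) Q^T], the factor [(-i)^n det (M t)] is
   [prod_j (1 + i lam_j) = rho exp(i sum_j atan lam_j)] with [rho > 0], so
   [(-i)^n det (M t) exp(- i F t)] stays real; the claim is the vanishing of the
   imaginary part of its derivative. *)
Lemma derive_sum_atan_eigenvalues (R : realType) n (x : R) (A : R -> 'M[R]_n)
    (B Q : 'M[R]_n) (lam : R -> 'I_n -> R) (dF : R) :
  (forall i j, is_derive x 1 (fun t => A t i j) (B i j)) ->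
  (\forall t \near x, char_poly (A t) = \prod_(i < n) ('X - (lam t i)%:P)) ->
  Q *m Q^T = 1%:M -> Q *m A x *m Q^T = diag_mx (\row_i lam x i) ->
  is_derive x 1 (fun t => \sum_i atan (lam t i)) dF ->
  dF = \sum_i (Q *m B *m Q^T) i i / (1 + lam x i ^+ 2).
Proof.
move=> DA charA QQ QAQ DF; set F := fun t => _ in DF.
pose iC : R[i] := 0 +i* 1; pose toC := real_complex R.
have [N NE] : exists N, N = Q *m B *m Q^T by eexists.
rewrite -NE.
pose M t := iC%:M - map_mx toC (Q *m A t *m Q^T).
have ME t i j : M t i j = iC *+ (i == j) - toC ((Q *m A t *m Q^T) i j).
  by rewrite /M; move: (Q *m A t *m Q^T) => C; rewrite !mxE.
have detM t : char_poly (A t) = \prod_(i < n) ('X - (lam t i)%:P) ->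
    \det (M t) = \prod_i (iC - toC (lam t i)).
  move=> cA; rewrite det_char_poly -map_char_poly char_poly_conj // cA.
  rewrite rmorph_prod horner_prod; apply: eq_bigr => i _.
  by rewrite /= rmorphB /= map_polyX map_polyC !hornerE.
have iK l : (iC - toC l) * - iC = 1 +i* l.
  apply/eqP; rewrite eq_complex ReM ImM /=.
  by rewrite !(oppr0, mulr0, add0r, subr0, mul0r, addr0, mulrN1, opprK) !eqxx.
pose G t := \det (M t) * (- iC) ^+ n * cexpi (- F t).
pose rho t := \prod_i Num.sqrt (1 + lam t i ^+ 2).
have GE t : char_poly (A t) = \prod_(i < n) ('X - (lam t i)%:P) ->
    G t = (rho t)%:C.
  move=> cA; rewrite /G (detM t cA).
  have -> : (- iC) ^+ n = \prod_(i < n) (- iC) by rewrite prodr_const card_ord.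
  rewrite -big_split /=.
  under eq_bigr do rewrite iK.
  rewrite prod_cexpi_atan -mulrA -cexpiD subrr /cexpi cos0 sin0.
  by rewrite -[RHS]mulr1.
have rho_gt0 : 0 < rho x.
  by apply: prodr_gt0 => i _; rewrite sqrtr_gt0 ltr_pwDl // sqr_ge0.
have charx := nbhs_singleton charA.
(* The logarithmic derivative of [\det (M t)] at [x], where [M x] is diagonal with entries i - lam_j
   and [M] has derivative [- N]. *)
pose d : R[i] := \sum_i - toC (N i i) / (iC - toC (lam x i)).
have z_neq0 i : iC - toC (lam x i) != 0.
  by rewrite eq_complex /= subr0 oner_eq0 andbF.
have DM i j : is_cderive x (fun t => M t i j) ((- map_mx toC N) i j).
  have DQA : is_derive x 1 (fun t => (Q *m A t *m Q^T) i j) (N i j).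
    rewrite NE mxE; under eq_fun do rewrite mxE; apply: is_derive_bigsum => k.
    rewrite !mxE; under eq_fun do rewrite !mxE.
    apply: is_derive_eq (is_derive_mul (is_derive_bigsum _ _ (fun l =>
      is_derive_mul (is_derive_const (Q i l) x 1) (DA l k))) (is_derive_const _ _ _)) _.
    rewrite mulr0 addr0; congr (_ * _); apply: eq_bigr => l _.
    by rewrite mul0r add0r.
  rewrite !mxE; split; under eq_fun do rewrite ME raddfB /=.
    rewrite raddfN /= -[X in is_derive _ _ _ X]add0r.
    exact: is_derive_add (is_derive_const _ _ _) (is_derive_opp DQA).
  by rewrite raddfN /= oppr0; exact: is_derive_const.
have DdetM : is_cderive x (fun t => \det (M t)) (d * \det (M x)).
  have MD i j : M x i j = (iC - toC (lam x i)) *+ (i == j).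
    rewrite /M QAQ !mxE; case: eqP => [->|_]; rewrite ?mulr1n ?mulr0n //.
    by rewrite [toC 0]rmorph0 subrr.
  have diagM i j : i != j -> M x i j = 0 by move=> ij; rewrite MD (negbTE ij).
  have DP := is_cderive_det_diag DM diagM.
  apply: is_cderive_eq DP _; rewrite big_distrl; apply: eq_bigr => i _ /=.
  rewrite (detM _ charx) [in RHS](bigD1 i) //= mulrA divfK //; congr (_ * _).
    by rewrite !mxE.
  by apply: eq_bigr => j _; rewrite MD eqxx.
have DG : is_cderive x G ((d - 0 +i* dF) * G x).
  have DE := is_cderive_cexpi (is_derive_opp DF).
  have DP := is_cderive_mul (is_cderive_mul DdetM
    (is_cderive_const x ((- iC) ^+ n))) DE.
  apply: is_cderive_eq DP _.
  rewrite /G; have -> : (0 +i* (- dF)) = - (0 +i* dF).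
    by apply/eqP; rewrite eq_complex /= oppr0 !eqxx.
  by ring.
have ImG : Im ((d - 0 +i* dF) * G x) = 0.
  case: DG => _ DGi; apply: is_derive_unique DGi _.
  apply: near_eq_is_derive (is_derive_const 0 x 1).
  by near=> t; rewrite GE //; near: t.
(* As [G x] is the positive real [rho x], it can be divided out, leaving dF = Im d; and Im (- N_ii /
   (i - lam_i)) = N_ii / (1 + lam_i^2). *)
move: ImG; rewrite (GE _ charx) ImM /= mulr0 add0r => /eqP.
rewrite mulf_eq0 (gt_eqF rho_gt0) orbF raddfB /= subr_eq0 => /eqP <-.
rewrite /d raddf_sum; apply: eq_bigr => i _ /=.
rewrite oppr0 mul0r !addr0 mulrNN add0r sqrrN expr1n div1r.
by rewrite [_ ^+ 2 + 1]addrC.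
Unshelve. all: by end_near. Qed.

End ComplexDerivative.

(** * Calculus on row vectors *)

Lemma l2norm_rowE (R : realType) n (x : 'rV[R]_n) :
  l2norm x = Num.sqrt (\sum_i x 0 i ^+ 2).
Proof. by rewrite /l2norm big_ord1. Qed.

Lemma l2norm_ge0 (R : realType) m n (x : 'M[R]_(m, n)) : 0 <= l2norm x.
Proof. exact: sqrtr_ge0. Qed.

Lemma sqr_l2norm (R : realType) n (x : 'rV[R]_n) :
  l2norm x ^+ 2 = \sum_i x 0 i ^+ 2.
Proof. by rewrite l2norm_rowE sqr_sqrtr // sumr_ge0 // => i _; rewrite sqr_ge0. Qed.

Lemma ler_sqr_sum (R : realDomainType) n (x : 'rV[R]_n) i :
  x 0 i ^+ 2 <= \sum_j x 0 j ^+ 2.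
Proof. by rewrite (bigD1 i) //= lerDl sumr_ge0 // => j _; rewrite sqr_ge0. Qed.

Lemma cauchy_schwarz (R : realType) n (x y : 'rV[R]_n) :
  `|\sum_i x 0 i * y 0 i| <= l2norm x * l2norm y.
Proof.
rewrite -(@ler_sqr R) ?nnegrE ?mulr_ge0 ?l2norm_ge0 ?normr_ge0 //.
rewrite real_normK ?num_real // exprMn !sqr_l2norm.
set a := \sum_i x 0 i ^+ 2; set b := \sum_i y 0 i ^+ 2; set c := \sum_i _ * _.
have a0 : 0 <= a by apply: sumr_ge0 => i _; exact: sqr_ge0.
have b0 : 0 <= b by apply: sumr_ge0 => i _; exact: sqr_ge0.
(* With a = |x|^2, b = |y|^2 and c = <x, y>, the nonnegative quantity |a y - c x|^2 expands to a (a
   b - c^2). Dividing by a settles the case a > 0; otherwise x = 0. *)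
have H : 0 <= \sum_i (a * y 0 i - c * x 0 i) ^+ 2.
  by apply: sumr_ge0 => i _; exact: sqr_ge0.
have E : \sum_i (a * y 0 i - c * x 0 i) ^+ 2 = a * (a * b - c ^+ 2).
  have sumE (p q : R) : \sum_i (p * y 0 i - q * x 0 i) ^+ 2 =
      p ^+ 2 * (\sum_i y 0 i ^+ 2) - (2 * p * q) * (\sum_i x 0 i * y 0 i)
      + q ^+ 2 * (\sum_i x 0 i ^+ 2).
    by rewrite !mulr_sumr -sumrB -big_split /=; apply: eq_bigr => i _; ring.
  by rewrite sumE -/a -/b -/c; ring.
rewrite E in H; have [a_eq0|a_neq0] := eqVneq a 0; last first.
  by rewrite -subr_ge0 -(pmulr_rge0 _ (_ : 0 < a)) // lt_def a_neq0 a0.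
have x0 i : x 0 i = 0.
  apply/eqP; rewrite -sqrf_eq0 eq_le sqr_ge0 andbT -a_eq0; exact: ler_sqr_sum.
by rewrite /c big1 ?expr0n ?mulr_ge0 // => i _; rewrite x0 mul0r.
Qed.

Lemma cvg_bigsum (R : realType) (T : Type) (F : set_system T) {FF : Filter F}
    (I : Type) (r : seq I) (f : I -> T -> R) (l : I -> R) :
  (forall i, f i @ F --> l i) ->
  (fun t => \sum_(i <- r) f i t) @ F --> \sum_(i <- r) l i.
Proof.
move=> fl; elim: r => [|i r IH].
  by rewrite big_nil; under eq_fun do rewrite big_nil; exact: cvg_cst.
by rewrite big_cons; under eq_fun do rewrite big_cons; exact: cvgD.
Qed.

Lemma l2norm_cvg (R : realType) n (T : Type) (F : set_system T) {FF : Filter F}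
    (f : T -> 'rV[R]_n) (l : 'rV[R]_n) :
  (forall i, f t 0 i @[t --> F] --> l 0 i) ->
  l2norm (f t) @[t --> F] --> l2norm l.
Proof.
move=> fl; rewrite l2norm_rowE; under eq_fun do rewrite l2norm_rowE.
apply: continuous_cvg; first exact: sqrt_continuous.
by apply: cvg_bigsum => i; exact: (@cvgM R T F _ _ _ _ _ (fl i) (fl i)).
Qed.

Lemma continuous_l2norm (R : realType) n : continuous (@l2norm R 1 n).
Proof. by move=> x; apply: (@l2norm_cvg R n _ (nbhs x) _ id) => i; exact: coord_continuous. Qed.

Lemma open_unit_ball (R : realType) n : open (@unit_ball R n).
Proof.
rewrite (_ : unit_ball n = @l2norm R 1 n @^-1` [set r | r < 1]) //.
by apply: open_comp; [move=> x _; exact: continuous_l2norm|exact: open_lt].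
Qed.

Lemma cvg_line (R : realType) (V : normedModType R) (x e : V) (t : R) :
  x + s *: e @[s --> t] --> x + t *: e.
Proof. by apply: cvgD; [exact: cvg_cst|apply: cvgZr_tmp; exact: cvg_id]. Qed.

Lemma near_line (R : realType) (V : normedModType R) (A : set V) (x e : V) :
  open A -> A x -> \forall t \near (0 : R), A (x + t *: e).
Proof.
move=> oA Ax; have := @cvg_line R V x e 0; rewrite scale0r addr0; apply.
exact: open_nbhs_nbhs.
Qed.

Lemma is_derive_comp_diff (R : realType) (V W : normedModType R) (g : R -> V)
    (f : V -> W) (t : R) (v : V) :
  is_derive t 1 g v -> differentiable f (g t) ->
  is_derive t 1 (fun s => f (g s)) ('d f (g t) v).
Proof.
move=> [/derivable1_diffP dg gv] df.
have dfg : differentiable (f \o g) t by exact: differentiable_comp.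
apply: DeriveDef; first exact/derivable1_diffP.
by rewrite deriveE // diff_comp //= -gv deriveE.
Qed.

Lemma is_derive_affine (R : realType) (V : normedModType R) (x e : V) (t : R) :
  is_derive t 1 (fun s => x + s *: e) e.
Proof.
have De : is_derive t 1 (fun s : R => s *: e) e.
  have [d dE] : is_diff t ( *:%R^~ e) ( *:%R^~ e : R -> V) by exact: is_diff_scalel.
  apply: DeriveDef; first exact/derivable1_diffP.
  by rewrite deriveE // dE scale1r.
exact: is_derive_eq (is_derive_add (is_derive_const _ _ _) De) (add0r e).
Qed.

Lemma diff_partial (R : realType) n (f : 'rV[R]_n -> R) (x e : 'rV[R]_n) :
  differentiable f x -> 'd f x e = \sum_k e 0 k * partial k f x.
Proof.
move=> df; rewrite {1}[e]row_sum_delta linear_sum; apply: eq_bigr => k _.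
by rewrite linearZ /partial deriveE.
Qed.

Lemma is_derive_line (R : realType) n (f : 'rV[R]_n -> R) (x e : 'rV[R]_n) (t : R) :
  differentiable f (x + t *: e) ->
  is_derive t 1 (fun s => f (x + s *: e))
    (\sum_k e 0 k * partial k f (x + t *: e)).
Proof.
move=> df; rewrite -diff_partial //.
exact: is_derive_comp_diff (is_derive_affine _ _ _) _.
Qed.

Lemma is_derive_line_delta (R : realType) n (f : 'rV[R]_n -> R) (x : 'rV[R]_n)
    (i : 'I_n) (t : R) :
  differentiable f (x + t *: delta_mx 0 i) ->
  is_derive t 1 (fun s => f (x + s *: delta_mx 0 i))
    (partial i f (x + t *: delta_mx 0 i)).
Proof.
move=> df; apply: is_derive_eq (is_derive_line df) _.
rewrite (bigD1 i) //= big1 ?addr0 => [|k ki]; first by rewrite mxE !eqxx mul1r.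
by rewrite mxE (negbTE ki) andbF mul0r.
Qed.

(** * Mean value theorem, symmetry of second partials, derivative tests, chain rule *)

Lemma MVT_is_derive (R : realType) (f df : R -> R) (a b : R) : a < b ->
  (forall x, a <= x <= b -> is_derive x 1 f (df x)) ->
  exists2 c, a < c < b & f b - f a = df c * (b - a).
Proof.
move=> ab Df; have [c| |c] := @MVT R f df a b ab.
- by rewrite in_itv /= => /andP[ac cb]; apply: Df; rewrite !ltW.
- apply: derivable_within_continuous => x; rewrite in_itv /= => /Df.
  by case.
by rewrite in_itv /=; exists c.
Qed.

(** The mean value theorem is used twice: on the increment of [f] along [j], seen as a function of
    the coordinate along [i], and then on [partial i f] along [j]. The left side is symmetric in [i]
    and [j], which is what makes mixed partials commute. *)
Lemma second_difference (R : realType) n (f : 'rV[R]_n -> R) (i j : 'I_n)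
    (x : 'rV[R]_n) (r : R) (P := fun a b => x + a *: delta_mx 0 i + b *: delta_mx 0 j) :
  0 < r ->
  (forall a b, 0 <= a <= r -> 0 <= b <= r -> differentiable f (P a b) /\
     differentiable (partial i f) (P a b)) ->
  exists a b, [/\ 0 <= a <= r, 0 <= b <= r &
    f (P r r) - f (P r 0) - (f (P 0 r) - f (P 0 0)) =
    partial j (partial i f) (P a b) * r ^+ 2].
Proof.
move=> r_gt0 df; have r0 := ltW r_gt0; have PE a b : P a b = (x + b *: delta_mx 0 j) + a *: delta_mx 0 i.
  by rewrite /P addrAC.
have r0r : 0 <= r <= r by rewrite r0 lexx.
have r00 : 0 <= (0 : R) <= r by rewrite lexx r0.
pose g a := f (P a r) - f (P a 0).
have Dg a : 0 <= a <= r ->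
    is_derive a 1 g (partial i f (P a r) - partial i f (P a 0)).
  move=> ar; apply: is_derive_add; [|apply: is_derive_opp].
    rewrite PE; under eq_fun do rewrite PE.
    by apply: is_derive_line_delta; rewrite -PE; case: (df a r ar r0r).
  rewrite PE; under eq_fun do rewrite PE.
  by apply: is_derive_line_delta; rewrite -PE; case: (df a 0 ar r00).
have [a /andP[/ltW a0 /ltW ar] ->] := MVT_is_derive r_gt0 Dg.
have Dh b : 0 <= b <= r ->
    is_derive b 1 (fun b => partial i f (P a b)) (partial j (partial i f) (P a b)).
  move=> b0r; apply: is_derive_line_delta; apply: (df a b _ _).2 => //.
  by rewrite a0.
have [b /andP[/ltW b0 /ltW br] ->] := MVT_is_derive r_gt0 Dh.
by exists a, b; split; rewrite ?a0 ?b0 // !subr0; ring.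
Qed.

(** The two orders of differentiation give the same second difference over a small square, hence
    equal values at two points close to [x]; continuity at [x] brings both mixed partials within
    [e / 2] of that common value. *)
Lemma partialC (R : realType) n (A : set 'rV[R]_n) (f : 'rV[R]_n -> R)
    (i j : 'I_n) (x : 'rV[R]_n) :
  open A -> Ck_on 2 A f -> A x ->
  partial i (partial j f) x = partial j (partial i f) x.
Proof.
move=> oA f2 Ax.
have cij : {for x, continuous (partial i (partial j f))}.
  by have [_] := f2 [:: i; j] x Ax; apply.
have cji : {for x, continuous (partial j (partial i f))}.
  by have [_] := f2 [:: j; i] x Ax; apply.
apply/eqP; rewrite -subr_eq0 -normr_le0; apply/ler_addgt0Pr => e e0.
rewrite add0r.
have e2 : 0 < e / 2 by rewrite divr_gt0.
have nA : \forall y \near x, A y by exact: open_nbhs_nbhs.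
have /cvgrPdist_lt/(_ _ e2) n1 := cij.
have /cvgrPdist_lt/(_ _ e2) n2 := cji.
have nx := filterI (filterI nA n1) n2.
have [d /= d0 dx] := (nbhs_ballP _ _).1 (nx _ _).
(* Two steps of length at most d / 3 stay inside the ball of radius d. *)
pose r := d / 3.
have r0 : 0 < r by rewrite divr_gt0.
have Pd a b (k l : 'I_n) : 0 <= a <= r -> 0 <= b <= r ->
    ball x d (x + a *: delta_mx 0 k + b *: delta_mx 0 l).
  move=> /andP[a0 ar] /andP[b0 br].
  rewrite -ball_normE /= -addrA opprD addNKr normrN.
  apply: le_lt_trans (ler_normD _ _) _.
  have nd c (m : 'I_n) : 0 <= c -> `|c *: (delta_mx 0 m : 'rV[R]_n)| <= c.
    move=> c0; rewrite normrZ ger0_norm // ler_piMr //.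
    rewrite [`|_|]mx_normrE; apply: bigmax_le => // ij _.
    by rewrite mxE; case: (_ && _); rewrite ?normr1 ?normr0.
  by have := nd a k a0; have := nd b l b0; rewrite /r in ar br *; lra.
have dP (k l : 'I_n) a b : 0 <= a <= r -> 0 <= b <= r ->
    differentiable f (x + a *: delta_mx 0 k + b *: delta_mx 0 l) /\
    differentiable (partial k f) (x + a *: delta_mx 0 k + b *: delta_mx 0 l).
  move=> ar br; have [[Ay _] _] := dx _ (Pd a b k l ar br); split.
    by have [+ _] := f2 [::] _ Ay; apply.
  by have [+ _] := f2 [:: k] _ Ay; apply.
have [a [b [ar br E1]]] := second_difference r0 (dP i j).
have [a' [b' [ar' br' E2]]] := second_difference r0 (dP j i).
pose y := x + a *: delta_mx 0 i + b *: delta_mx 0 j.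
pose y' := x + a' *: delta_mx 0 j + b' *: delta_mx 0 i.
have H1 : `|partial j (partial i f) x - partial j (partial i f) y| < e / 2.
  exact: (dx _ (Pd a b i j ar br)).2.
have H2 : `|partial i (partial j f) x - partial i (partial j f) y'| < e / 2.
  exact: (dx _ (Pd a' b' j i ar' br')).1.2.
have : partial j (partial i f) (x + a *: delta_mx 0 i + b *: delta_mx 0 j) =
       partial i (partial j f) (x + a' *: delta_mx 0 j + b' *: delta_mx 0 i).
  apply: (mulIf (_ : r ^+ 2 != 0)); first by rewrite expf_neq0 // gt_eqF.
  apply: etrans (esym E1) (etrans _ E2); rewrite !scale0r !addr0.
  by rewrite [x + _ *: _ + _ in RHS]addrAC; ring.
rewrite -/y -/y' => E; rewrite E in H1; move: H1 H2.
move: (partial j _ x) (partial i _ x) (partial i _ y') => p q s.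
rewrite !ltr_norml => /andP[h1 h2] /andP[h3 h4].
rewrite ler_norml; clear -h1 h2 h3 h4; apply/andP.
by split; lra.
Qed.

(** For the second test, [q2 > 0] together with [q1 0 = 0] would make [q1] positive just to the
    right of 0, and the mean value theorem would give a point there with a value above [q 0]. Only
    differentiability of [q1] at 0 is involved. *)
Lemma derivative_tests_max (R : realType) (q q1 : R -> R) (q2 : R) :
  (\forall t \near (0 : R), is_derive (t : R) 1 q (q1 t)) ->
  is_derive (0 : R) 1 q1 q2 -> (\forall t \near (0 : R), q t <= q 0) ->
  q1 0 = 0 /\ q2 <= 0.
Proof.
move=> nDq Dq1 nmax.
have [d /= d0 dP] : exists2 d : R, 0 < d & forall t : R, `|t| < d ->
    is_derive (t : R) 1 q (q1 t) /\ q t <= q 0.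
  have [d /= d0 dP] := (nbhs_ballP _ _).1 (filterI nDq nmax).
  by exists d => // t td; apply: dP; rewrite -ball_normE /= sub0r normrN.
have q10 : q1 0 = 0.
  have D0 : is_derive (0 : R) 1 q 0.
    apply: (@derive1_at_max R q (- d) d 0); first by lra.
    - by move=> t; rewrite in_itv /= -ltr_norml => /dP[[]].
    - by rewrite in_itv /= oppr_lt0 d0.
    - by move=> t; rewrite in_itv /= -ltr_norml => /dP[].
  have [Dq _] : is_derive (0 : R) 1 q (q1 0) /\ q 0 <= q 0 by apply: dP; rewrite normr0.
  exact: is_derive_unique Dq D0.
split=> //; rewrite leNgt; apply/negP => q2_gt0.
have [dq1 q2E] := Dq1.
have := dq1; rewrite /derivable => /(cvgr_gt _) /(_ 0).
rewrite -/(derive q1 0 1) q2E => /(_ q2_gt0).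
rewrite near_withinE => /nbhs_ballP[r /= r0 rP].
pose h := Num.min d r / 2.
have m0 : 0 < Num.min d r by rewrite lt_min d0.
have h0 : 0 < h by rewrite divr_gt0.
have hm : h < Num.min d r by rewrite /h; lra.
move: hm; rewrite lt_min => /andP[hd hr].
have Dh (x : R) : 0 <= x <= h -> is_derive x 1 q (q1 x).
  by move=> /andP[x0 xh]; apply: (dP x _).1; rewrite ger0_norm //; lra.
have [c /andP[c0 ch] qE] := MVT_is_derive h0 Dh.
have : 0 < q1 c.
  have := rP c; rewrite -ball_normE /= sub0r normrN gtr0_norm // => /(_ _ _).
  rewrite gt_eqF // => /(_ (lt_trans ch hr) isT).
  by rewrite scaler1 addr0 q10 subr0 /GRing.scale /= pmulr_rgt0 // invr_gt0.
have : q h <= q 0 by apply: (dP h _).2; rewrite gtr0_norm.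
rewrite -subr_le0 qE subr0 pmulr_lle0 // => /le_lt_trans H /H.
by rewrite ltxx.
Qed.

Lemma is_derive_pair (R : realType) (V W : normedModType R) (f : R -> V)
    (g : R -> W) (t : R) (v : V) (w : W) :
  is_derive t 1 f v -> is_derive t 1 g w ->
  is_derive t 1 (fun s => (f s, g s)) (v, w).
Proof.
move=> [/derivable1_diffP df fv] [/derivable1_diffP dg gw].
apply: DeriveDef; first exact/derivable1_diffP/differentiable_pair.
rewrite deriveE; last exact: differentiable_pair.
by rewrite diff_pair // -!deriveE // fv gw.
Qed.

Lemma is_derive_row (R : realType) n (f : R -> 'rV[R]_n) (t : R) (v : 'rV[R]_n) :
  (forall i, is_derive t 1 (fun s => f s 0 i) (v 0 i)) -> is_derive t 1 f v.
Proof.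
move=> Df; have df : derivable f t 1.
  by apply/derivable_mxP => i j; rewrite ord1; case: (Df j).
apply: DeriveDef => //; rewrite derive_mx //; apply/rowP => j.
by rewrite mxE; case: (Df j).
Qed.

(** The velocity of the curve (x, u, Du) is split into its three slots. By linearity of the
    differential each slot is treated alone, and comparison with the curve that moves only in that
    slot identifies it with [D_x], [D_z] or [D_p]. *)
Lemma is_derive_composed_phase (R : realType) n (u : 'rV[R]_n -> R)
    (Theta : 'rV[R]_n -> R -> 'rV[R]_n -> R) (x xi : 'rV[R]_n) :
  differentiable u x -> (forall k, differentiable (partial k u) x) ->
  differentiable (fun v : 'rV[R]_n * R * 'rV[R]_n => Theta v.1.1 v.1.2 v.2)
    (x, u x, grad u x) ->
  is_derive (0 : R) 1
    (fun t => Theta (x + t *: xi) (u (x + t *: xi)) (grad u (x + t *: xi)))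
    (\sum_k xi 0 k * D_x Theta x (u x) (grad u x) 0 k
     + (\sum_k xi 0 k * partial k u x) * D_z Theta x (u x) (grad u x)
     + \sum_l (\sum_k xi 0 k * partial k (partial l u) x)
         * D_p Theta x (u x) (grad u x) 0 l).
Proof.
move=> du ddu dTheta; set f := fun v : _ * _ * _ => _ in dTheta.
set z := u x; set p := grad u x.
have x0 : x + 0 *: xi = x by rewrite scale0r addr0.
pose b := \sum_k xi 0 k * partial k u x.
pose c : 'rV[R]_n := \row_l \sum_k xi 0 k * partial k (partial l u) x.
have Db : is_derive (0 : R) 1 (fun t => u (x + t *: xi)) b.
  by rewrite /b -{2}x0; apply: is_derive_line; rewrite x0.
have Dc : is_derive (0 : R) 1 (fun t => grad u (x + t *: xi)) c.
  apply: is_derive_row => l; under eq_fun do rewrite mxE.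
  by rewrite mxE -{2}x0; apply: is_derive_line; rewrite x0.
have Dg := is_derive_pair (is_derive_pair (is_derive_affine x xi 0) Db) Dc.
have df : differentiable f (x + 0 *: xi, u (x + 0 *: xi), grad u (x + 0 *: xi)).
  by rewrite x0.
apply: is_derive_eq (is_derive_comp_diff Dg df) _.
rewrite x0 -/z -/p.
have -> : (xi, b, c) = (xi, 0, 0) + (0, b, 0) + (0, 0, c) :> _ * _ * _.
  transitivity (xi + 0 + 0, 0 + b + 0, 0 + 0 + c) => //.
  by rewrite !(addr0, add0r).
rewrite !linearD /=; congr (_ + _ + _).
- have dx : differentiable (fun y : 'rV[R]_n => (y, z, p)) x.
    by do 2!apply: differentiable_pair => //.
  have dfx : differentiable (fun y => Theta y z p) (x + 0 *: xi).
    by rewrite x0; exact: (differentiable_comp dx dTheta).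
  have Dx := is_derive_pair (is_derive_pair (is_derive_affine x xi 0)
    (is_derive_const z _ _)) (is_derive_const p _ _).
  have dTx : differentiable f (x + 0 *: xi, z, p) by rewrite x0.
  have := is_derive_unique (is_derive_comp_diff Dx dTx) (is_derive_line dfx).
  by rewrite x0 => ->; apply: eq_bigr => k _; rewrite /D_x mxE.
- have Dz : is_derive z 1 (fun s => (x, s, p)) (0, 1, 0).
    exact: is_derive_pair (is_derive_pair (is_derive_const _ _ _) (is_derive_id _ _))
      (is_derive_const _ _ _).
  have [_ Dzf] := is_derive_comp_diff Dz dTheta.
  rewrite /D_z derive1E Dzf -/z -/p.
  have -> : (0, b, 0) = b *: (0, 1, 0) :> 'rV[R]_n * R * 'rV[R]_n.
    transitivity (b *: 0 : 'rV[R]_n, b * 1, b *: 0 : 'rV[R]_n) => //.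
    by rewrite !scaler0 mulr1.
  by rewrite linearZ.
- have dp : differentiable (fun y : 'rV[R]_n => (x, z, y)) p.
    by apply: differentiable_pair.
  have p0 : p + 0 *: c = p by rewrite scale0r addr0.
  have dfp : differentiable (fun y => Theta x z y) (p + 0 *: c).
    by rewrite p0; exact: (differentiable_comp dp dTheta).
  have Dp := is_derive_pair (is_derive_pair (is_derive_const x _ _)
    (is_derive_const z _ _)) (is_derive_affine p c 0).
  have dTp : differentiable f (x, z, p + 0 *: c) by rewrite p0.
  have := is_derive_unique (is_derive_comp_diff Dp dTp) (is_derive_line dfp).
  by rewrite p0 => ->; apply: eq_bigr => k _; rewrite /D_p !mxE.
Qed.

(** * The algebraic inequality at a maximum point *)

Lemma atan_le_id (R : realType) (y : R) : 0 < y -> atan y <= y.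
Proof.
move=> y0; have [c /andP[c0 _]] :=
  @MVT_is_derive R atan (fun x => (1 + x ^+ 2)^-1) 0 y y0 (fun x _ => is_derive1_atan x).
rewrite atan0 !subr0 => ->; rewrite (ler_piMl (ltW y0)) // invf_le1.
  by rewrite lerDl sqr_ge0.
by rewrite ltr_pwDl // sqr_ge0.
Qed.

(** The left side equals atan (1 / L). *)
Lemma pihalf_sub_atan_le (R : realType) (L : R) :
  0 < L -> pi / 2 - atan L <= L^-1.
Proof.
move=> L0; have t0 : 0 < atan L by rewrite -[X in X < _](@atan0 R) lt_atan.
have tpi := atan_ltpi2 L; have pi0 := @pi_gt0 R.
have -> : pi / 2 - atan L = atan L^-1.
  rewrite -[LHS]tanK ?in_itv /=; last by apply/andP; split; lra.
  rewrite /tan sinB cosB cos_pihalf sin_pihalf !mul0r subr0 !mul1r add0r.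
  by rewrite -{3}[L]atanK /tan invf_div.
by rewrite atan_le_id // invr_gt0.
Qed.

Definition phase_excess (R : realType) n (lam : 'I_n -> R) : R :=
  \sum_i atan (lam i) - (n%:R - 2) * (pi / 2).

(** The complementary angles pi/2 - atan lam_i are nonnegative, so keeping only one or two of them
    in this sum bounds the excess from above. *)
Lemma sum_pihalf_sub_atan (R : realType) n (lam : 'I_n -> R) :
  \sum_i (pi / 2 - atan (lam i)) = pi - phase_excess lam.
Proof.
by rewrite sumrB sumr_const card_ord -mulr_natr /phase_excess; lra.
Qed.

Lemma pihalf_sub_atan_ge0 (R : realType) (l : R) : 0 <= pi / 2 - atan l.
Proof. by rewrite subr_ge0 ltW // atan_ltpi2. Qed.

Lemma phase_excess_le (R : realType) n (lam : 'I_n -> R) i :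
  phase_excess lam <= pi / 2 + atan (lam i).
Proof.
have := sum_pihalf_sub_atan lam; rewrite (bigD1 i) //=.
have : 0 <= \sum_(j | j != i) (pi / 2 - atan (lam j)).
  by apply: sumr_ge0 => j _; exact: pihalf_sub_atan_ge0.
by lra.
Qed.

Lemma phase_excess_le2 (R : realType) n (lam : 'I_n -> R) i j : j != i ->
  phase_excess lam <= atan (lam i) + atan (lam j).
Proof.
move=> ji; have := sum_pihalf_sub_atan lam; rewrite (bigD1 i) //= (bigD1 j) //=.
have : 0 <= \sum_(k | (k != i) && (k != j)) (pi / 2 - atan (lam k)).
  by apply: sumr_ge0 => k _; exact: pihalf_sub_atan_ge0.
by lra.
Qed.

(** A nonnegative excess forces the arctangents of any two eigenvalues to have nonnegative sum. *)
Lemma negative_eigenvalue_le (R : realType) n (lam : 'I_n -> R) i j : j != i ->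
  0 <= phase_excess lam -> - lam i <= lam j.
Proof.
move=> ji e0; rewrite leNgt; apply/negP => /lt_atan; rewrite atanN.
by have := phase_excess_le2 lam ji; lra.
Qed.

Lemma phase_excess_le_inv (R : realType) n (lam : 'I_n -> R) i : lam i < 0 ->
  phase_excess lam <= (- lam i)^-1.
Proof.
move=> li; have := phase_excess_le lam i.
have := @pihalf_sub_atan_le R (- lam i); rewrite oppr_gt0 atanN => /(_ li).
by lra.
Qed.

Lemma exists_large_component (R : realFieldType) n (xi : 'I_n -> R) :
  \sum_i xi i ^+ 2 = 1 -> exists i, n%:R^-1 <= xi i ^+ 2.
Proof.
move=> xi1; have n0 : (0 < n)%N.
  rewrite lt0n; apply/eqP => n0; move: xi xi1; rewrite n0 => xi'.
  by rewrite big_ord0 => /esym/eqP; rewrite oner_eq0.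
apply/existsP; apply: contraT; rewrite negb_exists => /forallP small.
have : \sum_i xi i ^+ 2 < \sum_(i < n) n%:R^-1.
  apply: ltr_sum => [|i _]; last by rewrite ltNge.
  by apply/hasP; exists (Ordinal n0).
rewrite xi1 sumr_const card_ord -[_ *+ n]mulr_natr mulVf ?ltxx //.
by rewrite pnatr_eq0 -lt0n.
Qed.

Lemma norm_component_le1 (R : realFieldType) n (xi : 'I_n -> R) i :
  \sum_i xi i ^+ 2 = 1 -> `|xi i| <= 1.
Proof.
move=> xi1; rewrite -(@ler_sqr R) ?nnegrE // real_normK ?num_real // expr1n -xi1.
by rewrite (bigD1 i) //= lerDl sumr_ge0 // => j _; rewrite sqr_ge0.
Qed.

(** The last equation hypothesis is the first order condition along an eigenvector with eigenvalue
    [l], [q] being the component of xi and [h] the derivative of the cutoff. Multiplied by [q] it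
    reads - l q^2 = (h q + f1 q^2) w / eta. Since |h q| <= 4 <= 4 N q^2 and f1 lies in [8 N, 9 N],
    the bracket lies between (8 - 4) N q^2 and (9 + 4) N q^2. *)
Lemma eigenvalue_bounds (R : realFieldType) (N w eta f1 h l q : R) :
  1 <= N -> 0 < w -> 0 < eta -> 8 * N <= f1 -> f1 <= 9 * N -> `|h| <= 4 ->
  `|q| <= 1 -> N^-1 <= q ^+ 2 -> h * w + eta * (l * q) + f1 * w * q = 0 ->
  4 * N * (w / eta) <= - l <= 13 * N * (w / eta).
Proof.
move=> N1 w0 eta0 f1_ge f1_le h4 q1 qN E.
have N0 : 0 < N by rewrite (lt_le_trans ltr01).
have NQ : 1 <= N * q ^+ 2 by rewrite -ler_pdivrMl // mulr1.
have Q0 : 0 < q ^+ 2 by rewrite (lt_le_trans _ qN) // invr_gt0.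
set y := w / eta; have y0 : 0 < y by rewrite divr_gt0.
have lE : - l * q ^+ 2 = (h * q + f1 * q ^+ 2) * y.
  have yE : eta * y = w by rewrite /y mulrC divfK // gt_eqF.
  have {}E : l * q = - (h * y) - f1 * y * q.
    apply: (mulfI (negbT (gt_eqF eta0))); move: E; rewrite -yE.
    by clear; lra.
  have -> : - l * q ^+ 2 = - (l * q) * q by ring.
  by rewrite E; ring.
have hq : `|h * q| <= 4 * N * q ^+ 2.
  rewrite normrM -[4 * N * _]mulrA; apply: ler_pM => //.
  exact: le_trans q1 NQ.
move: hq; rewrite ler_norml => /andP[hq1 hq2].
have lo : 4 * N * q ^+ 2 <= h * q + f1 * q ^+ 2.
  have := ler_wpM2r (ltW Q0) f1_ge; move: hq1; clear; lra.
have up : h * q + f1 * q ^+ 2 <= 13 * N * q ^+ 2.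
  have := ler_wpM2r (ltW Q0) f1_le; move: hq2; clear; lra.
apply/andP; split; rewrite -(ler_pM2r Q0) lE.
  by rewrite mulrAC ler_pM2r.
by rewrite [leRHS]mulrAC ler_pM2r.
Qed.

(** Here [L] is minus the negative eigenvalue and [delta] the phase excess. In terms of r = sqrt
    (eta w) and y = w / eta one has w^2 = r^2 y; multiplying the hypothesis by 1 + L^2 and dividing
    by y leaves a quadratic inequality r^2 <= N^3 m (c + 94 Ca r), which bounds r. *)
Lemma gradient_bound_scalar (R : realType) (N w eta m Ca Cc L delta : R) :
  1 <= N -> 0 < w -> 0 < eta -> eta <= 1 -> 1 <= m -> 0 <= Ca -> 0 <= Cc ->
  4 * N * (w / eta) <= L -> L <= 13 * N * (w / eta) ->
  0 <= delta -> delta <= L^-1 ->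
  (1 + L ^+ 2)^-1 * (w ^+ 2 / (N * m) - 229 * N ^+ 2 * (w / eta))
    <= eta * (Ca * Num.sqrt delta) + 13 * N * Cc * delta ->
  eta * w <= (N ^+ 3 * (229 + 338 * Cc + 94 * Ca) * m) ^+ 2.
Proof.
move=> N1 w0 eta0 eta1 m1 Ca0 Cc0 L_ge L_le d0 d_le H.
have N0 : 0 < N by rewrite (lt_le_trans ltr01).
have m0 : 0 < m by rewrite (lt_le_trans ltr01).
set K := 229 + 338 * Cc + 94 * Ca.
have K1 : 1 <= K by move: Cc0 Ca0; rewrite /K; clear; lra.
have N31 : 1 <= N ^+ 3 by rewrite exprn_ege1.
have NKm1 : 1 <= N ^+ 3 * K * m by rewrite !mulr_ege1.
(* The claimed bound is at least 1, so only eta w > 1 matters; then r, y and L are all at least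
   1. *)
have [small|large] := leP (eta * w) 1.
  by apply: le_trans small _; rewrite exprn_ege1.
set r := Num.sqrt (eta * w).
have ew0 : 0 < eta * w by rewrite mulr_gt0.
have r0 : 0 < r by rewrite sqrtr_gt0.
have r2 : r ^+ 2 = eta * w by rewrite sqr_sqrtr // ltW.
have r1 : 1 <= r by rewrite -[1](@sqrtr1 R) ler_sqrt // ltW.
set y := w / eta in L_ge L_le H.
have y0 : 0 < y by rewrite divr_gt0.
have wE : w = eta * y by rewrite /y mulrC divfK // gt_eqF.
clearbody y.
have y1 : 1 <= y.
  apply: le_trans (ltW large) _.
  by rewrite wE mulrA ler_piMl ?(ltW y0) // mulr_ile1 // ltW.
have L1 : 1 <= L.
  by apply: le_trans L_ge; rewrite !mulr_ege1 // ler1n.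
have L0 : 0 < L by rewrite (lt_le_trans ltr01).
set s := Num.sqrt delta in H.
have s0 : 0 <= s by rewrite sqrtr_ge0.
have s2 : s ^+ 2 = delta by rewrite sqr_sqrtr.
have dL : delta * L <= 1 by rewrite -ler_pdivlMr // div1r.
have d_L2 : L ^+ 2 * delta <= 13 * N * y.
  apply: le_trans L_le; rewrite expr2 -mulrA [L * delta]mulrC.
  by rewrite ler_piMr // ltW.
(* Compare squares: L^4 delta <= L^3 <= (13 N y)^3, and 13^3 = 2197 <= 2209 = 47^2. *)
have z_le : eta * (L ^+ 2 * s) <= 47 * N ^+ 2 * y * r.
  rewrite -(@ler_sqr R) ?nnegrE; last 2 first.
  - by rewrite !mulr_ge0 // ?exprn_ge0 // ltW.
  - by rewrite !mulr_ge0 // ?exprn_ge0 // ltW.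
  have -> : (eta * (L ^+ 2 * s)) ^+ 2 = eta ^+ 2 * L ^+ 3 * (delta * L).
    by rewrite -s2; ring.
  have -> : (47 * N ^+ 2 * y * r) ^+ 2 = 2209 * N ^+ 4 * y ^+ 2 * (eta * w).
    by rewrite -r2; ring.
  rewrite wE; apply: (@le_trans _ _ (eta ^+ 2 * (13 * N * y) ^+ 3)).
    apply: (@le_trans _ _ (eta ^+ 2 * L ^+ 3)).
      by rewrite ler_piMr // mulr_ge0 // exprn_ge0 // ltW.
    rewrite ler_wpM2l ?exprn_ge0 ?(ltW eta0) // lerXn2r ?nnegrE ?(ltW L0) //.
    by rewrite !mulr_ge0 // ltW.
  have -> : eta ^+ 2 * (13 * N * y) ^+ 3 = 2197 * N ^+ 3 * (eta ^+ 2 * y ^+ 3).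
    by ring.
  have -> : 2209 * N ^+ 4 * y ^+ 2 * (eta * (eta * y)) =
      (2209 * N) * N ^+ 3 * (eta ^+ 2 * y ^+ 3) by ring.
  rewrite ler_wpM2r //; first by rewrite mulr_ge0 ?exprn_ge0 // ltW.
  rewrite ler_wpM2r ?exprn_ge0 ?(ltW N0) //.
  by move: N1; clear; lra.
set A := w ^+ 2 / (N * m) - _ in H.
(* The weight satisfies 1 + L^2 <= 2 L^2, whence 94 = 2 * 47 and 338 = 2 * 13 * 13. *)
have A_le : A <= y * N ^+ 2 * (94 * Ca * r + 338 * Cc).
  have L2 : 0 < 1 + L ^+ 2 by rewrite ltr_pwDl // sqr_ge0.
  move: H; rewrite ler_pdivrMl // => H; apply: le_trans H _.
  have L22 : 1 + L ^+ 2 <= 2 * L ^+ 2.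
    have : 1 <= L ^+ 2 by rewrite exprn_ege1.
    by clear; lra.
  have rhs0 : 0 <= eta * (Ca * s) + 13 * N * Cc * delta.
    by rewrite addr_ge0 // !mulr_ge0 // ltW.
  apply: le_trans (ler_wpM2r rhs0 L22) _.
  have -> : 2 * L ^+ 2 * (eta * (Ca * s) + 13 * N * Cc * delta) =
      2 * Ca * (eta * (L ^+ 2 * s)) + 26 * N * Cc * (L ^+ 2 * delta) by ring.
  have -> : y * N ^+ 2 * (94 * Ca * r + 338 * Cc) =
      2 * Ca * (47 * N ^+ 2 * y * r) + 26 * N * Cc * (13 * N * y) by ring.
  apply: lerD; apply: ler_wpM2l => //; first by rewrite mulr_ge0.
  by rewrite !mulr_ge0 // ltW.
have w2E : w ^+ 2 = r ^+ 2 * y.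
  by rewrite r2 {1}wE [in RHS]wE; ring.
have r2_le : r ^+ 2 <= N ^+ 3 * m * (229 + 94 * Ca * r + 338 * Cc).
  have Nm0 : 0 < N * m by rewrite mulr_gt0.
  have : r ^+ 2 * y / (N * m) <= y * N ^+ 2 * (229 + 94 * Ca * r + 338 * Cc).
    by move: A_le; rewrite /A w2E; clear; lra.
  rewrite ler_pdivrMr // => ry; rewrite -(ler_pM2r y0); apply: le_trans ry _.
  by rewrite le_eqVlt; apply/orP; left; apply/eqP; ring.
(* As r >= 1, the terms free of r are absorbed into K r, and one factor r cancels. *)
have : r <= N ^+ 3 * K * m.
  rewrite -(ler_pM2r r0) -expr2; apply: le_trans r2_le _.
  have -> : N ^+ 3 * K * m * r = N ^+ 3 * m * (K * r) by ring.
  apply: ler_wpM2l; first by rewrite mulr_ge0 ?exprn_ge0 // ltW.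
  have c0 : 0 <= 229 + 338 * Cc by move: Cc0; clear; lra.
  have := ler_wpM2l c0 r1; rewrite /K; clear; lra.
rewrite -r2 => rK; apply: lerXn2r => //; rewrite ?nnegrE ?(ltW r0) //.
exact: le_trans ler01 NKm1.
Qed.

(** The data are components in an eigenframe: [h] of the gradient of the cutoff, [T] of the third
    derivatives of u contracted with xi. The last three hypotheses are the first order conditions,
    the second order conditions and the lower bound from the differentiated equation. Summing the
    second order conditions with weights 1 / (1 + lam_j^2) eliminates [T]. *)
Lemma max_point_bound (R : realType) n (Ca Cc w eta m f1 : R)
    (xi h lam T : 'I_n -> R) :
  0 < w -> 0 < eta -> eta <= 1 -> 1 <= m -> 0 <= Ca -> 0 <= Cc ->
  8 * n%:R <= f1 -> f1 <= 9 * n%:R ->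
  \sum_i xi i ^+ 2 = 1 -> (forall i, `|h i| <= 4) -> 0 <= phase_excess lam ->
  (forall i, h i * w + eta * (lam i * xi i) + f1 * w * xi i = 0) ->
  (forall i, - 8 * w + 2 * h i * (lam i * xi i) + eta * T i
     + w ^+ 2 * xi i ^+ 2 / m + f1 * lam i <= 0) ->
  - (Ca * Num.sqrt (phase_excess lam) + Cc * phase_excess lam * (13 * n%:R / eta))
    <= \sum_i T i / (1 + lam i ^+ 2) ->
  eta * w <= (n%:R ^+ 3 * (229 + 338 * Cc + 94 * Ca) * m) ^+ 2.
Proof.
move=> w0 eta0 eta1 m1 Ca0 Cc0 f1_ge f1_le xi1 h4 e0 fo so lin.
have [i xi_i] := exists_large_component xi1.
have xi_le1 j := norm_component_le1 j xi1.
have N1 : 1 <= n%:R :> R by rewrite ler1n (leq_ltn_trans _ (ltn_ord i)).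
move: f1_ge f1_le xi_i lin; set N : R := n%:R in N1 * => f1_ge f1_le xi_i lin.
have N0 : 0 < N by rewrite (lt_le_trans ltr01).
have m0 : 0 < m by rewrite (lt_le_trans ltr01).
have f10 : 0 <= f1 by apply: le_trans f1_ge; rewrite mulr_ge0 // ltW.
have /andP[L_ge L_le] := eigenvalue_bounds N1 w0 eta0 f1_ge f1_le (h4 i)
  (xi_le1 i) xi_i (fo i).
have [y yD] : exists y, y = w / eta by eexists.
rewrite -yD in L_ge L_le.
have y0 : 0 < y by rewrite yD divr_gt0.
have wE : w = eta * y by rewrite yD mulrC divfK // gt_eqF.
have w_le_y : w <= y by rewrite wE ler_piMl // ltW.
pose L := - lam i; have L0 : 0 < L.
  by apply: lt_le_trans L_ge; rewrite !mulr_gt0.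
have li0 : lam i < 0 by rewrite -oppr_gt0.
have lam_ge j : j != i -> L <= lam j by move=> ji; exact: negative_eigenvalue_le.
pose g := (1 + L ^+ 2)^-1.
have sqr1_gt0 (l : R) : 0 < 1 + l ^+ 2 by rewrite ltr_pwDl // sqr_ge0.
have g0 : 0 < g by rewrite invr_gt0.
have gj0 j : 0 < (1 + lam j ^+ 2)^-1 by rewrite invr_gt0.
(* No eigenvalue is smaller in modulus than [lam i], so index [i] carries the largest weight. *)
have gj_le j : (1 + lam j ^+ 2)^-1 <= g.
  rewrite lef_pV2 ?posrE // lerD2l; have [->|ji] := eqVneq j i.
    by rewrite sqrrN.
  have Lj := lam_ge j ji; have l0 := le_trans (ltW L0) Lj.
  by apply: lerXn2r; rewrite ?nnegrE ?(ltW L0).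
have lamxi_le j : `|lam j * xi j| <= 13 * N * y.
  have -> : lam j * xi j = - (h j + f1 * xi j) * y.
    apply: (mulfI (negbT (gt_eqF eta0))); have := fo j; rewrite wE.
    by clear; lra.
  rewrite normrM normrN (gtr0_norm y0) ler_wpM2r ?(ltW y0) //.
  apply: le_trans (ler_normD _ _) _; rewrite normrM (ger0_norm f10).
  have := h4 j; have := ler_wpM2l f10 (xi_le1 j); move: f1_le N1; clear; lra.
have hlx j : - (52 * N * y) <= h j * (lam j * xi j).
  have : `|h j * (lam j * xi j)| <= 4 * (13 * N * y) by rewrite normrM ler_pM.
  rewrite ler_norml => /andP[+ _]; clear; lra.
have yNy : y <= N * y by rewrite ler_peMl // ltW.
(* Here lam_j > 0, so the term f1 lam_j has a favourable sign; 112 = 8 + 2 * 52. *)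
have other j : j != i -> eta * T j <= 112 * N * y.
  move=> ji; have l0 := le_trans (ltW L0) (lam_ge j ji).
  have q0 : 0 <= w ^+ 2 * xi j ^+ 2 / m.
    by apply: divr_ge0 (ltW m0); apply: mulr_ge0; exact: sqr_ge0.
  have := mulr_ge0 f10 l0.
  have := so j; have := hlx j; move: q0 w_le_y yNy; clear; lra.
(* At index [i] the term f1 lam_i is unfavourable and costs 9 N * 13 N y, while xi_i^2 >= 1/N makes
   the square term gain w^2 / (N m). *)
have self : eta * T i <= 112 * N * y + 117 * N ^+ 2 * y - w ^+ 2 / (N * m).
  have q0 : w ^+ 2 / (N * m) <= w ^+ 2 * xi i ^+ 2 / m.
    rewrite invfM mulrA ler_wpM2r ?invr_ge0 ?(ltW m0) //.
    by rewrite ler_wpM2l // sqr_ge0.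
  have fl : f1 * L <= 9 * N * (13 * N * y).
    by apply: ler_pM => //; exact: ltW L0.
  have := so i; have := hlx i; move: q0 w_le_y yNy fl; rewrite /L; clear; lra.
have gi : (1 + lam i ^+ 2)^-1 = g by rewrite /g /L sqrrN.
have c0 : 0 <= 112 * N * y by rewrite !mulr_ge0 // ltW.
(* The N indices together contribute 112 N^2 y, and 229 = 112 + 117. *)
have etaT : eta * (\sum_j T j / (1 + lam j ^+ 2)) <=
    g * (229 * N ^+ 2 * y - w ^+ 2 / (N * m)).
  rewrite mulr_sumr (bigD1 i) //= mulrA gi.
  have : \sum_(j | j != i) eta * (T j / (1 + lam j ^+ 2)) <=
      \sum_(j | j != i) 112 * N * y * g.
    apply: ler_sum => j ji; rewrite mulrA.
    apply: le_trans (ler_wpM2r (ltW (gj0 j)) (other j ji)) _.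
    exact: ler_wpM2l.
  have : \sum_(j < n) 112 * N * y * g = 112 * N * y * g * N.
    by rewrite sumr_const card_ord -[_ *+ n]mulr_natr.
  rewrite (bigD1 i) //=; have := ler_wpM2r (ltW g0) self; clear; lra.
have yE : eta * (13 * N / eta) = 13 * N by rewrite mulrC divfK // gt_eqF.
apply: (gradient_bound_scalar N1 w0 eta0 eta1 m1 Ca0 Cc0 _ _ e0 (phase_excess_le_inv li0));
  rewrite -?yD //.
rewrite -/L -/g; have := ler_wpM2l (ltW eta0) lin; move: etaT.
have -> : eta * - (Ca * Num.sqrt (phase_excess lam) +
    Cc * phase_excess lam * (13 * N / eta)) =
  - (eta * (Ca * Num.sqrt (phase_excess lam)) +
    Cc * phase_excess lam * (eta * (13 * N / eta))) by ring.
rewrite yE; clear; lra.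
Qed.

(** * The maximum principle *)

(** Written through the partials, so that linearity in [e] is visible and further differentiation
    proceeds term by term. *)
Definition dirD (R : realType) n (e : 'rV[R]_n) (f : 'rV[R]_n -> R)
    (x : 'rV[R]_n) : R :=
  \sum_k e 0 k * partial k f x.

Lemma is_derive_lincomb (R : realType) n (c : 'I_n -> R) (F : 'I_n -> R -> R)
    (dF : 'I_n -> R) (t : R) :
  (forall k, is_derive t 1 (F k) (dF k)) ->
  is_derive t 1 (fun s => \sum_k c k * F k s) (\sum_k c k * dF k).
Proof.
move=> DF; exact: is_derive_bigsum (fun k => is_deriveZ (c k) (DF k)).
Qed.

Lemma smooth_differentiable (R : realType) n (A : set 'rV[R]_n)
    (u : 'rV[R]_n -> R) (s : seq 'I_n) (x : 'rV[R]_n) :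
  smooth_on A u -> A x -> differentiable (partials s u) x.
Proof. by move=> su Ax; have [+ _] := su (size s).+1 s x Ax; apply. Qed.

Lemma is_derive_dirD (R : realType) n (A : set 'rV[R]_n) (u : 'rV[R]_n -> R)
    (s : seq 'I_n) (x e : 'rV[R]_n) (t : R) :
  smooth_on A u -> A (x + t *: e) ->
  is_derive t 1 (fun r => partials s u (x + r *: e))
    (dirD e (partials s u) (x + t *: e)).
Proof.
by move=> su Ax; apply: is_derive_line; exact: smooth_differentiable su Ax.
Qed.

Definition cutoff (R : realType) n (x : 'rV[R]_n) : R := 1 - 4 * \sum_k x 0 k ^+ 2.

Lemma is_derive_coord_line (R : realType) n (x e : 'rV[R]_n) (t : R) k :
  is_derive t 1 (fun r => (x + r *: e) 0 k) (e 0 k).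
Proof.
under eq_fun do rewrite !mxE.
exact: is_derive_affine (x 0 k : R^o) (e 0 k : R^o) t.
Qed.

Lemma is_derive_cutoff (R : realType) n (x e : 'rV[R]_n) (t : R) :
  is_derive t 1 (fun r => cutoff (x + r *: e))
    (- 8 * \sum_k e 0 k * (x + t *: e) 0 k).
Proof.
pose c k := (x + t *: e) 0 k.
have D2 : is_derive t 1 (fun r => \sum_k (x + r *: e) 0 k ^+ 2)
    (\sum_k (e 0 k * c k + c k * e 0 k)).
  apply: is_derive_bigsum => k; under eq_fun do rewrite expr2.
  exact: is_derive_mul (is_derive_coord_line x e t k) (is_derive_coord_line x e t k).
have := is_derive_add (is_derive_const (1 : R) t 1)
  (is_derive_opp (is_derive_mul (is_derive_const (4 : R) t 1) D2)).
move=> /is_derive_eq; apply; rewrite mul0r !add0r -mulNr !mulr_sumr.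
by apply: eq_bigr => k _; rewrite /c; ring.
Qed.

(** The derivative tests along the line x + t e, for the cutoff times <xi, Du> plus f(u), with f(s)
    = a s + s^2 / (2 m) shifted by [b] and [f1] its slope at x. The direction [e] is not normalised:
    eigenvectors will be used, and also [D_p Theta]. *)
Lemma directional_tests (R : realType) n (u : 'rV[R]_n -> R) (x xi e : 'rV[R]_n)
    (a b m : R) (f1 := a + (u x - b) / m) :
  m != 0 -> smooth_on (unit_ball n) u -> unit_ball n x ->
  (\forall y \near x,
     cutoff y * dirD xi u y + (a * (u y - b) + (u y - b) ^+ 2 / (2 * m)) <=
     cutoff x * dirD xi u x + (a * (u x - b) + (u x - b) ^+ 2 / (2 * m))) ->
  let h := - 8 * \sum_k e 0 k * x 0 k in
  let v1 := \sum_k xi 0 k * dirD e (partial k u) x in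
  h * dirD xi u x + cutoff x * v1 + f1 * dirD e u x = 0 /\
  (- 8 * \sum_k e 0 k ^+ 2) * dirD xi u x + 2 * h * v1
    + cutoff x * (\sum_k xi 0 k * \sum_l e 0 l * dirD e (partials [:: l; k] u) x)
    + dirD e u x ^+ 2 / m + f1 * (\sum_l e 0 l * dirD e (partial l u) x) <= 0.
Proof.
move=> m0 su bx nmax h v1.
pose U t := u (x + t *: e) - b.
pose U1 t := dirD e u (x + t *: e).
pose V t := dirD xi u (x + t *: e).
pose V1 t := \sum_k xi 0 k * dirD e (partial k u) (x + t *: e).
pose E t := cutoff (x + t *: e).
pose E1 t := - 8 * \sum_k e 0 k * (x + t *: e) 0 k.
pose q t := E t * V t + (a * U t + U t ^+ 2 / (2 * m)).
pose q1 t := E1 t * V t + E t * V1 t + (a + U t / m) * U1 t.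
have x0 : x + 0 *: e = x by rewrite scale0r addr0.
have DU t : unit_ball n (x + t *: e) -> is_derive (t : R) 1 U (U1 t).
  move=> bt; exact: is_derive_eq (is_derive_add (is_derive_dirD [::] su bt)
    (is_derive_const (- b) _ _)) (addr0 _).
have DV t : unit_ball n (x + t *: e) -> is_derive (t : R) 1 V (V1 t).
  move=> bt; apply: is_derive_lincomb => k.
  exact: (is_derive_dirD [:: k] su bt).
have Dq : \forall t \near (0 : R), is_derive (t : R) 1 q (q1 t).
  apply: filterS (near_line e (@open_unit_ball R n) bx) => t bt.
  have DUt := DU t bt.
  have DU2 := is_derive_mul DUt DUt.
  apply: is_derive_eq (is_derive_add (is_derive_mul (is_derive_cutoff x e t) (DV t bt))
    (is_derive_add (is_derive_mul (is_derive_const a t 1) DUt)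
      (is_derive_mul DU2 (is_derive_const (2 * m)^-1 t 1)))) _.
  by rewrite /q1 /E /E1; field.
have b0 : unit_ball n (x + 0 *: e) by rewrite x0.
pose q2 := - 8 * (\sum_k e 0 k ^+ 2) * V 0 + 2 * E1 0 * V1 0
  + E 0 * (\sum_k xi 0 k * \sum_l e 0 l * dirD e (partials [:: l; k] u) x)
  + U1 0 ^+ 2 / m + (a + U 0 / m) * (\sum_l e 0 l * dirD e (partial l u) x).
have Dq1 : is_derive (0 : R) 1 q1 q2.
  have DE1 : is_derive (0 : R) 1 E1 (- 8 * (\sum_k e 0 k ^+ 2)).
    apply: is_derive_eq (is_derive_mul (is_derive_const (- 8 : R) (0 : R) 1)
      (is_derive_lincomb (e 0) (fun k => is_derive_coord_line x e 0 k))) _.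
    by rewrite mul0r add0r.
  have DV1 : is_derive (0 : R) 1 V1
      (\sum_k xi 0 k * \sum_l e 0 l * dirD e (partials [:: l; k] u) x).
    rewrite -{1}x0; apply: is_derive_lincomb => k; apply: is_derive_lincomb => l.
    exact: (is_derive_dirD [:: l; k] su b0).
  have DU1 : is_derive (0 : R) 1 U1 (\sum_l e 0 l * dirD e (partial l u) x).
    rewrite -{1}x0; apply: is_derive_lincomb => l.
    exact: (is_derive_dirD [:: l] su b0).
  apply: is_derive_eq (is_derive_add (is_derive_add
     (is_derive_mul DE1 (DV 0 b0)) (is_derive_mul (is_derive_cutoff x e 0) DV1))
     (is_derive_mul (is_derive_add (is_derive_const a (0 : R) 1)
       (is_derive_mul (DU 0 b0) (is_derive_const m^-1 (0 : R) 1))) DU1)) _.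
  by rewrite /q2 -/(E1 0) -/(E 0); ring.
have nq : \forall t \near (0 : R), q t <= q 0.
  rewrite /q /E /V /U x0.
  have cx := @cvg_line R _ x e 0; rewrite x0 in cx.
  exact: (cx _ nmax).
have [] := derivative_tests_max Dq Dq1 nq.
by rewrite /q1 /q2 /E1 /V /V1 /E /U /U1 x0.
Qed.

Lemma partials_cat (R : realType) n (s t : seq 'I_n) (u : 'rV[R]_n -> R) :
  partials s (partials t u) = partials (s ++ t) u.
Proof. by rewrite /partials foldr_cat. Qed.

Lemma smooth_partials (R : realType) n (A : set 'rV[R]_n) (s : seq 'I_n)
    (u : 'rV[R]_n -> R) : smooth_on A u -> smooth_on A (partials s u).
Proof.
move=> su k t x Ax; rewrite partials_cat; split=> _.
  exact: smooth_differentiable su Ax.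
exact: differentiable_continuous (smooth_differentiable _ su Ax).
Qed.

(** The differentiated equation has the xi-derivative outermost, the second order test has it
    innermost. The inner exchange holds on a neighbourhood of [x], so it survives a further
    derivative. *)
Lemma partials3C (R : realType) n (A : set 'rV[R]_n) (u : 'rV[R]_n -> R)
    (i j k : 'I_n) (x : 'rV[R]_n) : open A -> smooth_on A u -> A x ->
  partials [:: k; i; j] u x = partials [:: i; j; k] u x.
Proof.
move=> oA su Ax; rewrite /= (partialC k i oA (smooth_partials [:: j] su 2) Ax).
rewrite /partial; apply: near_eq_derive.
have nA : nbhs x A by exact: open_nbhs_nbhs.
apply: filterS nA => y Ay; exact: partialC oA (su 2) Ay.
Qed.

Lemma hessian_sym (R : realType) n (A : set 'rV[R]_n) (u : 'rV[R]_n -> R)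
    (x : 'rV[R]_n) : open A -> smooth_on A u -> A x ->
  (hessian u x)^T = hessian u x.
Proof.
move=> oA su Ax; apply/matrixP => i j; rewrite !mxE.
exact: partialC oA (su 2) Ax.
Qed.

Lemma dirD_hessian (R : realType) n (u : 'rV[R]_n -> R) (x e f : 'rV[R]_n) :
  \sum_k f 0 k * dirD e (partial k u) x = (e *m hessian u x *m f^T) 0 0.
Proof.
rewrite mxE; apply: eq_bigr => k _; rewrite !mxE mulrC; congr (_ * _).
by apply: eq_bigr => l _; rewrite mxE.
Qed.

Lemma dirD_le_l2norm (R : realType) n (u : 'rV[R]_n -> R) (x e : 'rV[R]_n) :
  l2norm e <= 1 -> dirD e u x <= l2norm (grad u x).
Proof.
move=> e1; have -> : dirD e u x = \sum_k e 0 k * (grad u x) 0 k.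
  by apply: eq_bigr => k _; rewrite mxE.
apply: le_trans (ler_norm _) _; apply: le_trans (cauchy_schwarz _ _) _.
by rewrite ler_piMl // l2norm_ge0.
Qed.

Lemma cutoff_ge0 (R : realType) n (x : 'rV[R]_n) :
  l2norm x <= 1 / 2 -> 0 <= cutoff x.
Proof.
move=> x2; rewrite /cutoff -sqr_l2norm.
have : l2norm x ^+ 2 <= (1 / 2) ^+ 2.
  by apply: lerXn2r; rewrite ?nnegrE ?l2norm_ge0 // divr_ge0.
by move: (l2norm x ^+ 2) => r; lra.
Qed.

Lemma cutoff_gt0 (R : realType) n (x : 'rV[R]_n) :
  l2norm x < 1 / 2 -> 0 < cutoff x.
Proof.
move=> x2; rewrite /cutoff -sqr_l2norm.
have : l2norm x ^+ 2 < (1 / 2) ^+ 2.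
  by apply: ltrXn2r; rewrite ?nnegrE ?l2norm_ge0 // divr_ge0.
by move: (l2norm x ^+ 2) => r; lra.
Qed.

Lemma cutoff_le1 (R : realType) n (x : 'rV[R]_n) : cutoff x <= 1.
Proof.
by rewrite /cutoff gerBl mulr_ge0 // sumr_ge0 // => i _; exact: sqr_ge0.
Qed.

Lemma l2norm_row_orthogonal (R : realType) n (Q : 'M[R]_n) i :
  Q *m Q^T = 1%:M -> l2norm (row i Q) = 1.
Proof.
move=> /matrixP/(_ i i); rewrite !mxE eqxx => Qi.
rewrite l2norm_rowE (_ : \sum_j _ = 1) ?sqrtr1 // -[RHS]Qi.
by apply: eq_bigr => j _; rewrite !mxE expr2.
Qed.

(** Both sides are the derivative along xi of the equation: the left through the determinant formula
    for the arctangent sum, with third partials reordered, the right through the chain rule. *)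
Lemma linearized_phase (R : realType) n (u : 'rV[R]_n -> R)
    (Theta : 'rV[R]_n -> R -> 'rV[R]_n -> R) (lambda : 'rV[R]_n -> 'I_n -> R)
    (x xi : 'rV[R]_n) (Q : 'M[R]_n) :
  smooth_on (unit_ball n) u ->
  (forall x, unit_ball n x -> eigenvalues (hessian u x) (lambda x)) ->
  (forall x, unit_ball n x ->
    \sum_(i < n) atan (lambda x i) = Theta x (u x) (grad u x)) ->
  differentiable (fun v : 'rV[R]_n * R * 'rV[R]_n => Theta v.1.1 v.1.2 v.2)
    (x, u x, grad u x) ->
  unit_ball n x -> Q *m Q^T = 1%:M ->
  Q *m hessian u x *m Q^T = diag_mx (\row_i lambda x i) ->
  \sum_i (\sum_k xi 0 k * \sum_l Q i l * dirD (row i Q) (partials [:: l; k] u) x)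
      / (1 + lambda x i ^+ 2) =
  \sum_k xi 0 k * D_x Theta x (u x) (grad u x) 0 k
  + dirD xi u x * D_z Theta x (u x) (grad u x)
  + \sum_l dirD xi (partial l u) x * D_p Theta x (u x) (grad u x) 0 l.
Proof.
move=> su eig eqn dTheta bx QQ QAQ.
have oB := @open_unit_ball R n.
have x0 : x + 0 *: xi = x by rewrite scale0r addr0.
have nB := near_line xi oB bx.
have b0 : unit_ball n (x + 0 *: xi) by rewrite x0.
pose B := \matrix_(i, j) dirD xi (partials [:: i; j] u) x.
have DA i j : is_derive (0 : R) 1 (fun t => hessian u (x + t *: xi) i j) (B i j).
  under eq_fun do rewrite mxE; rewrite mxE.
  by have := is_derive_dirD [:: i; j] su b0; rewrite x0.
have charA : \forall t \near (0 : R), char_poly (hessian u (x + t *: xi)) =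
    \prod_(i < n) ('X - (lambda (x + t *: xi) i)%:P).
  by apply: filterS nB => t; exact: eig.
have DTheta := is_derive_composed_phase xi (smooth_differentiable [::] su bx)
  (fun k => smooth_differentiable [:: k] su bx) dTheta.
have fg : \forall t \near (0 : R),
    Theta (x + t *: xi) (u (x + t *: xi)) (grad u (x + t *: xi)) =
    \sum_i atan (lambda (x + t *: xi) i).
  by apply: filterS nB => t bt; rewrite eqn.
have DF := near_eq_is_derive fg DTheta.
have QAQ0 : Q *m hessian u (x + 0 *: xi) *m Q^T =
    diag_mx (\row_i lambda (x + 0 *: xi) i) by rewrite x0.
rewrite /dirD (derive_sum_atan_eigenvalues DA charA QQ QAQ0 DF) x0.
apply: eq_bigr => i _; congr (_ / _).
transitivity (\sum_k xi 0 k * \sum_l Q i l * \sum_p Q i p * partials [:: k; p; l] u x).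
  apply: eq_bigr => k _; apply: (congr1 (fun z => xi 0 k * z)).
  apply: eq_bigr => l _; apply: (congr1 (fun z => Q i l * z)).
  apply: eq_bigr => p _; rewrite mxE; apply: (congr1 (fun z => Q i p * z)).
  exact: esym (partials3C p l k oB su bx).
rewrite [RHS]mxE; under [RHS]eq_bigr do rewrite mxE mulr_suml.
under [LHS]eq_bigr do rewrite mulr_sumr.
rewrite exchange_big; apply: eq_bigr => l _ /=.
under [LHS]eq_bigr do rewrite !mulr_sumr.
rewrite exchange_big; apply: eq_bigr => p _ /=.
rewrite [Q^T l i]mxE [B p l]mxE /dirD mulr_sumr mulr_suml.
by apply: eq_bigr => k _ /=; ring.
Qed.

(** Freezes xi = Du(x) / |Du(x)|, passes to an eigenframe given by the rows of [Q], and checks the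
    hypotheses of [max_point_bound]; the conditions on Theta enter only through the lower bound for
    its derivative along xi. *)
Lemma interior_max_bound (R : realType) n (Ca Cc b m : R) (u : 'rV[R]_n -> R)
    (Theta : 'rV[R]_n -> R -> 'rV[R]_n -> R) (lambda : 'rV[R]_n -> 'I_n -> R)
    (x : 'rV[R]_n) (p := grad u x) (F := fun s => 8 * n%:R * s + s ^+ 2 / (2 * m)) :
  0 <= Ca -> 0 <= Cc -> 1 <= m -> 1 <= n%:R :> R ->
  smooth_on (unit_ball n) u ->
  (forall x, unit_ball n x -> eigenvalues (hessian u x) (lambda x)) ->
  (forall x, unit_ball n x ->
    \sum_(i < n) atan (lambda x i) = Theta x (u x) (grad u x)) ->
  differentiable (fun v : 'rV[R]_n * R * 'rV[R]_n => Theta v.1.1 v.1.2 v.2)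
    (x, u x, p) ->
  critical_phase R n <= Theta x (u x) p ->
  l2norm (D_x Theta x (u x) p)
    <= Ca * Num.sqrt (Theta x (u x) p - critical_phase R n) ->
  0 <= D_z Theta x (u x) p ->
  l2norm p * l2norm (D_p Theta x (u x) p)
    <= Cc * (Theta x (u x) p - critical_phase R n) ->
  l2norm x < 1 / 2 -> b <= u x <= b + m -> 0 < l2norm p ->
  (\forall y \near x, cutoff y * l2norm (grad u y) + F (u y - b)
    <= cutoff x * l2norm p + F (u x - b)) ->
  cutoff x * l2norm p <= (n%:R ^+ 3 * (229 + 338 * Cc + 94 * Ca) * m) ^+ 2.
Proof.
move=> Ca0 Cc0 m1 n1 su eig eqn dTheta crit HDx HDz HDp x2 /andP[bu ub] w0 nmax.
have oB := @open_unit_ball R n.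
have m0 : 0 < m by rewrite (lt_le_trans ltr01).
have bx : unit_ball n x by apply: lt_trans x2 _; clear; lra.
set w := l2norm p in HDp w0 nmax *.
set eta := cutoff x in nmax *.
have eta0 : 0 < eta by exact: cutoff_gt0.
pose xi := w^-1 *: p.
have pE k : partial k u x = w * xi 0 k.
  by rewrite !mxE mulrA divff ?mul1r // gt_eqF.
have xi1 : \sum_k xi 0 k ^+ 2 = 1.
  under eq_bigr do rewrite mxE exprMn.
  by rewrite -mulr_sumr -sqr_l2norm -exprMn mulVf ?expr1n // gt_eqF.
have xi_norm : l2norm xi = 1 by rewrite l2norm_rowE xi1 sqrtr1.
have dxi e : dirD e u x = w * \sum_k e 0 k * xi 0 k.
  by rewrite mulr_sumr; apply: eq_bigr => k _; rewrite pE mulrCA.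
have dxiu : dirD xi u x = w.
  by rewrite dxi (_ : \sum_k _ = 1) ?mulr1.
(* <xi, Du> is at most |Du| with equality at x, and the cutoff is nonnegative nearby, so the maximum
   persists. *)
have nmax' : \forall y \near x,
    cutoff y * dirD xi u y + (8 * n%:R * (u y - b) + (u y - b) ^+ 2 / (2 * m)) <=
    cutoff x * dirD xi u x + (8 * n%:R * (u x - b) + (u x - b) ^+ 2 / (2 * m)).
  have n2 : \forall y \near x, l2norm y < 1 / 2.
    have /cvgr_lt := @continuous_l2norm R n x; exact.
  rewrite dxiu; apply: filterS2 nmax n2 => y Py y2; apply: le_trans Py.
  rewrite lerD2r; apply: ler_wpM2l; first exact: cutoff_ge0 (ltW y2).
  by rewrite dirD_le_l2norm // xi_norm.
pose f1 := 8 * n%:R + (u x - b) / m.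
have tests (e : 'rV[R]_n) (d v1 v2 d2 s : R) (h := - 8 * \sum_k e 0 k * x 0 k) :
    dirD e u x = d -> \sum_k xi 0 k * dirD e (partial k u) x = v1 ->
    \sum_k xi 0 k * \sum_l e 0 l * dirD e (partials [:: l; k] u) x = v2 ->
    \sum_l e 0 l * dirD e (partial l u) x = d2 -> \sum_k e 0 k ^+ 2 = s ->
    h * w + eta * v1 + f1 * d = 0 /\
    - 8 * s * w + 2 * h * v1 + eta * v2 + d ^+ 2 / m + f1 * d2 <= 0.
  move=> <- <- <- <- <-.
  have := directional_tests e (negbT (gt_eqF m0)) su bx nmax'.
  by rewrite dxiu.
have um : 0 <= (u x - b) / m <= 1.
  by rewrite divr_ge0 ?subr_ge0 ?(ltW m0) //= ler_pdivrMr // mul1r lerBlDl.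
have f1_ge : 8 * n%:R <= f1 by rewrite lerDl; case/andP: um.
have f1_le : f1 <= 9 * n%:R.
  by rewrite /f1; move: (_ / m) um => z /andP[_]; move: n1; clear; lra.
have [Q [QQ QAQ]] := symmetric_diagonalization (hessian_sym oB su bx) (eig x bx).
have QTQ : Q^T *m Q = 1%:M by exact: mulmx1C.
have QA : Q *m hessian u x = diag_mx (\row_i lambda x i) *m Q.
  by rewrite -QAQ -(mulmxA _ Q^T) QTQ mulmx1.
(* The components of xi in the eigenframe. *)
pose c := fun i => \sum_k (row i Q) 0 k * xi 0 k.
have rowA i : row i Q *m hessian u x = lambda x i *: row i Q.
  by rewrite -row_mul QA mul_diag_mx; apply/rowP => k; rewrite !mxE.
have v1E i : \sum_k xi 0 k * dirD (row i Q) (partial k u) x = lambda x i * c i.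
  rewrite dirD_hessian rowA -scalemxAl mxE [(_ *m _) 0 0]mxE; congr (_ * _).
  by rewrite /c; apply: eq_bigr => k _; rewrite [xi^T k 0]mxE.
have rowQ1 i : \sum_k (row i Q) 0 k ^+ 2 = 1.
  by rewrite -sqr_l2norm l2norm_row_orthogonal // expr1n.
have AE i : \sum_k (row i Q) 0 k * dirD (row i Q) (partial k u) x = lambda x i.
  rewrite dirD_hessian rowA -scalemxAl mxE.
  rewrite (_ : (_ *m _) 0 0 = 1) ?mulr1 // -(rowQ1 i) row_sqr //.
pose h := fun i => - 8 * \sum_k (row i Q) 0 k * x 0 k.
pose T := fun i => \sum_k xi 0 k * \sum_l Q i l * dirD (row i Q) (partials [:: l; k] u) x.
have TE i : \sum_k xi 0 k * \sum_l (row i Q) 0 l *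
    dirD (row i Q) (partials [:: l; k] u) x = T i.
  apply: eq_bigr => k _; apply: (congr1 (fun z => xi 0 k * z)).
  by apply: eq_bigr => l _; rewrite [row i Q 0 l]mxE.
have exE : phase_excess (lambda x) = Theta x (u x) p - critical_phase R n.
  by rewrite /phase_excess eqn.
apply: (@max_point_bound R n Ca Cc w eta m f1 c h (lambda x) T) => //.
- exact: cutoff_le1.
- have -> : \sum_i c i ^+ 2 = ((xi *m Q^T) *m (xi *m Q^T)^T) 0 0.
    rewrite row_sqr; apply: eq_bigr => i _; congr (_ ^+ 2).
    by rewrite [RHS]mxE; apply: eq_bigr => k _; rewrite !mxE mulrC.
  by rewrite trmx_mul trmxK mulmxA -(mulmxA xi) QTQ mulmx1 row_sqr.
(* The bound 4 is 8 |x| with |x| < 1/2. *)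
- move=> i; rewrite /h normrM normrN (ger0_norm (_ : 0 <= 8 :> R)) //.
  have := cauchy_schwarz (row i Q) x; rewrite l2norm_row_orthogonal // mul1r.
  by move: x2; clear; lra.
- by rewrite exE subr_ge0.
- move=> i; have [] := tests _ _ _ _ _ _ (dxi _) (v1E i) (TE i) (AE i) (rowQ1 i).
  by rewrite -/(h i) -/(c i) [f1 * (w * _)]mulrA.
- move=> i; have [_] := tests _ _ _ _ _ _ (dxi _) (v1E i) (TE i) (AE i) (rowQ1 i).
  by rewrite -/(h i) -/(c i) mulr1 exprMn.
rewrite (linearized_phase xi su eig eqn dTheta bx QQ QAQ) exE dxiu.
set del := Theta x (u x) p - critical_phase R n in HDx HDp *.
have dx_ge : - (Ca * Num.sqrt del) <= \sum_k xi 0 k * D_x Theta x (u x) p 0 k.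
  have := cauchy_schwarz xi (D_x Theta x (u x) p); rewrite xi_norm mul1r.
  by rewrite ler_norml => /andP[+ _]; move: HDx; clear; lra.
have dz_ge : 0 <= w * D_z Theta x (u x) p by rewrite mulr_ge0 // ltW.
(* The [D_p] term is the Hessian paired with xi and q = D_p Theta. The first order condition in
   direction q turns eta times it into - w (h + f1 <q, xi>), of size at most 13 n w |q| with 13 = 4
   + 9, and (c) bounds w |q| by Cc times the excess. *)
suff dp_ge : - (Cc * del * (13 * n%:R / eta)) <=
    \sum_l dirD xi (partial l u) x * D_p Theta x (u x) p 0 l.
  by move: dx_ge dz_ge dp_ge; rewrite -/p; clear; lra.
set q := D_p Theta x (u x) p in HDp *.
have v1q : \sum_k xi 0 k * dirD q (partial k u) x =
    \sum_l dirD xi (partial l u) x * q 0 l.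
  transitivity ((xi *m hessian u x *m q^T) 0 0).
    rewrite dirD_hessian.
    transitivity ((q *m hessian u x *m xi^T)^T 0 0); first by rewrite [RHS]mxE.
    by rewrite !trmx_mul trmxK mulmxA (hessian_sym oB su bx).
  by rewrite -dirD_hessian; apply: eq_bigr => l _; exact: mulrC.
have [tq _] := tests q _ _ _ _ _ (dxi q) v1q erefl erefl erefl.
move: tq; move: (\sum_l dirD xi _ _ * _) => z tq.
have qx : `|\sum_k q 0 k * x 0 k| <= l2norm q * (1 / 2).
  apply: le_trans (cauchy_schwarz _ _) _.
  by rewrite ler_wpM2l ?l2norm_ge0 // ltW.
have qxi : `|\sum_k q 0 k * xi 0 k| <= l2norm q.
  by have := cauchy_schwarz q xi; rewrite xi_norm mulr1.
move: qx qxi tq; move: (\sum_k q 0 k * x 0 k) (\sum_k q 0 k * xi 0 k) => s t qs qt tq.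
have q0 : 0 <= l2norm q := l2norm_ge0 _.
have f10 : 0 <= f1 by apply: le_trans f1_ge; rewrite mulr_ge0.
have ft : f1 * t <= 9 * n%:R * l2norm q.
  apply: le_trans (ler_wpM2r q0 f1_le); apply: ler_wpM2l => //.
  exact: le_trans (ler_norm _) qt.
have s4 : - 8 * s <= 4 * n%:R * l2norm q.
  have := ler_peMl q0 n1; move: qs; rewrite ler_norml => /andP[+ _]; clear; lra.
have : - (eta * z) <= w * (13 * n%:R * l2norm q).
  have -> : - (eta * z) = w * (- 8 * s + f1 * t) by move: tq; clear; lra.
  by rewrite ler_wpM2l ?(ltW w0) //; move: ft s4; clear; lra.
move=> ez; rewrite lerNl -(ler_pM2l eta0) mulrN; apply: le_trans ez _.
have -> : eta * (Cc * del * (13 * n%:R / eta)) = Cc * del * (13 * n%:R).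
  by field; rewrite gt_eqF.
have -> : w * (13 * n%:R * l2norm q) = (w * l2norm q) * (13 * n%:R) by ring.
by rewrite ler_wpM2r // mulr_ge0.
Qed.

(** * Existence of the maximum and the final estimate *)

Lemma norm_le_l2norm (R : realType) n (x : 'rV[R]_n) : `|x| <= l2norm x.
Proof.
rewrite [leLHS]mx_normrE; apply: bigmax_le => [|[i j] _ /=]; first exact: l2norm_ge0.
rewrite ord1 -(@ler_sqr R) ?nnegrE ?l2norm_ge0 // real_normK ?num_real //.
by rewrite sqr_l2norm ler_sqr_sum.
Qed.

Lemma compact_half_ball (R : realType) n :
  compact [set x : 'rV[R]_n | l2norm x <= 1 / 2].
Proof.
apply: bounded_closed_compact.
  exists (1 / 2); split; first exact: num_real.
  move=> M M2 x /= x2; apply: le_trans (norm_le_l2norm x) _.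
  exact: le_trans x2 (ltW M2).
rewrite (_ : [set x | _] = @l2norm R 1 n @^-1` [set r | r <= 1 / 2]) //.
by apply: closed_comp; [move=> x _; exact: continuous_l2norm|exact: closed_le].
Qed.

Lemma continuous_cutoff (R : realType) n : continuous (@cutoff R n).
Proof.
move=> x; have c i : (fun y : 'rV[R]_n => y 0 i ^+ 2) @ x --> x 0 i ^+ 2.
  exact: (@cvgM R _ (nbhs x) _ _ _ _ _ (@coord_continuous R 1 n 0 i x)
    (@coord_continuous R 1 n 0 i x)).
have s : (fun y : 'rV[R]_n => \sum_i y 0 i ^+ 2) @ x --> \sum_i x 0 i ^+ 2.
  exact: (@cvg_bigsum R _ (nbhs x) (nbhs_filter x) _ _ _ _ c).
have m := @cvgM R _ (nbhs x) _ _ _ _ _ (cvg_cst (4 : R)) s.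
have r := @cvgB R R _ (nbhs x) _ _ _ _ _ (cvg_cst (1 : R)) (m _ _).
exact: r.
Qed.

Lemma continuous_l2norm_grad (R : realType) n (A : set 'rV[R]_n)
    (u : 'rV[R]_n -> R) (x : 'rV[R]_n) :
  smooth_on A u -> A x -> {for x, continuous (fun y => l2norm (grad u y))}.
Proof.
move=> su Ax; apply: (@l2norm_cvg R n _ (nbhs x) _ (grad u)) => i.
rewrite mxE; under eq_fun do rewrite mxE.
have c : {for x, continuous (partial i u)}.
  exact: differentiable_continuous (smooth_differentiable [:: i] su Ax).
exact: c.
Qed.

(** Let P be the auxiliary function, maximised over the compact half ball. At the origin the cutoff
    is 1 and F >= 0, so |Du(0)| <= P(0) <= max P; at a maximum point the gradient term is bounded by
    [interior_max_bound] and F by 9 n m^2. *)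
Lemma gradient_bound_of_bounds (R : realType) n (Ca Cc b m : R) (u : 'rV[R]_n -> R)
    (Theta : 'rV[R]_n -> R -> 'rV[R]_n -> R) (lambda : 'rV[R]_n -> 'I_n -> R) :
  (0 < n)%N -> 0 < Ca -> 0 < Cc -> 1 <= m ->
  smooth_on (unit_ball n) u ->
  (forall x, unit_ball n x -> eigenvalues (hessian u x) (lambda x)) ->
  (forall x, unit_ball n x ->
    \sum_(i < n) atan (lambda x i) = Theta x (u x) (grad u x)) ->
  (forall w, Gamma1 u w ->
    differentiable
      (fun v : 'rV[R]_n * R * 'rV[R]_n => Theta v.1.1 v.1.2 v.2) w) ->
  (forall x z p, Gamma1 u (x, z, p) ->
    l2norm (D_x Theta x z p)
      <= Ca * Num.sqrt (Theta x z p - critical_phase R n)) ->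
  (forall x z p, Gamma1 u (x, z, p) -> 0 <= D_z Theta x z p) ->
  (forall x z p, Gamma1 u (x, z, p) ->
    l2norm p * l2norm (D_p Theta x z p)
      <= Cc * (Theta x z p - critical_phase R n)) ->
  (forall x, unit_ball n x -> b <= u x <= b + m) ->
  l2norm (grad u 0) <=
    ((n%:R ^+ 3 * (229 + 338 * Cc + 94 * Ca)) ^+ 2 + 9 * n%:R) * m ^+ 2.
Proof.
move=> n0 Ca0 Cc0 m1 su eig eqn dTheta HDx HDz HDp ubd.
have n1 : 1 <= n%:R :> R by rewrite ler1n.
have m0 : 0 < m by rewrite (lt_le_trans ltr01).
pose F s := 8 * n%:R * s + s ^+ 2 / (2 * m).
pose P x := cutoff x * l2norm (grad u x) + F (u x - b).
set B := [set x : 'rV[R]_n | l2norm x <= 1 / 2].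
have BS x : B x -> unit_ball n x.
  by move=> Bx; apply: le_lt_trans Bx _; clear; lra.
have F_ge0 s : 0 <= s -> 0 <= F s.
  move=> s0; apply: addr_ge0; first by rewrite !mulr_ge0.
  by rewrite divr_ge0 ?sqr_ge0 // mulr_ge0 // ltW.
have F_le x : unit_ball n x -> F (u x - b) <= 9 * n%:R * m ^+ 2.
  move=> /ubd /andP[bu ub].
  have s0 : 0 <= u x - b by rewrite subr_ge0.
  have sm : u x - b <= m by rewrite lerBlDl.
  rewrite /F; move: (u x - b) s0 sm => s s0 sm.
  have mm : m <= m ^+ 2 by rewrite expr2 ler_peMl // ltW.
  have s2 : s ^+ 2 / (2 * m) <= m.
    rewrite ler_pdivrMr ?mulr_gt0 // mulrCA -expr2.
    have : s ^+ 2 <= m ^+ 2 by rewrite lerXn2r // nnegrE // ltW.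
    by have := sqr_ge0 m; clear; lra.
  have ns : 8 * n%:R * s <= 8 * n%:R * m ^+ 2.
    by rewrite ler_wpM2l ?mulr_ge0 // (le_trans sm).
  have nm : m ^+ 2 <= n%:R * m ^+ 2 by rewrite ler_peMl // sqr_ge0.
  by move: ns s2 mm nm; clear; lra.
have norm0 : l2norm (0 : 'rV[R]_n) = 0.
  by rewrite l2norm_rowE big1 ?sqrtr0 // => i _; rewrite mxE expr0n.
have B0 : B 0 by rewrite /B /= norm0 divr_ge0.
have cP : {within B, continuous P}.
  apply: continuous_in_subspaceT => x; rewrite inE => /BS bx.
  have cu : {for x, continuous u}.
    exact: differentiable_continuous (smooth_differentiable [::] su bx).
  have cst r : {for x, continuous (fun _ : 'rV[R]_n => r : R)} by exact: cst_continuous.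
  have cub : {for x, continuous (fun y => u y - b)} by exact: continuousB cu (cst b).
  have cF : {for x, continuous (fun y => F (u y - b))}.
    exact: continuousD (continuousM (cst _) cub)
      (continuousM (continuousM cub cub) (cst _)).
  exact: continuousD (continuousM (@continuous_cutoff R n x)
    (continuous_l2norm_grad su bx)) cF.
have [x Bx xmax] := EVT_max_rV (ex_intro _ _ B0) (@compact_half_ball R n) cP.
rewrite inE in Bx; have bx := BS x Bx.
have P0 : l2norm (grad u 0) <= P 0.
  have /andP[bu _] := ubd 0 (BS 0 B0).
  rewrite /P /cutoff -sqr_l2norm norm0 expr0n mulr0 subr0 mul1r lerDl.
  by rewrite F_ge0 // subr_ge0.
apply: le_trans P0 (le_trans (xmax 0 (mem_set B0)) _).
rewrite [leRHS]mulrDl /P; apply: lerD (F_le x bx).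
(* A vanishing gradient, or a point on the sphere of radius 1/2 where the cutoff vanishes, leaves no
   gradient term to estimate. *)
have [w0|w0] := leP (l2norm (grad u x)) 0.
  have -> : l2norm (grad u x) = 0 by apply/le_anti; rewrite w0 l2norm_ge0.
  by rewrite mulr0; apply: mulr_ge0; exact: sqr_ge0.
have [x2|x2] := ltP (l2norm x) (1 / 2); last first.
  have -> : cutoff x = 0.
    have E : l2norm x = 1 / 2 by apply/le_anti; rewrite x2 andbT.
    by rewrite /cutoff -sqr_l2norm E; field.
  by rewrite mul0r; apply: mulr_ge0; exact: sqr_ge0.
have G : Gamma1 u (x, u x, grad u x) by split; [split => //; exists x|exists x].
(* The left side of (c) is nonnegative and [Cc] is positive, so the phase is at least critical,
   without absolute value. *)
have crit : critical_phase R n <= Theta x (u x) (grad u x).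
  rewrite -subr_ge0 -(pmulr_rge0 _ Cc0); apply: le_trans (HDp _ _ _ G).
  exact: mulr_ge0 (l2norm_ge0 _) (l2norm_ge0 _).
rewrite -exprMn.
apply: (interior_max_bound (ltW Ca0) (ltW Cc0) m1 n1 su eig eqn (dTheta _ G) crit
  (HDx _ _ _ G) (HDz _ _ _ G) (HDp _ _ _ G) x2 (ubd x bx) w0).
have n2 : \forall y \near x, l2norm y < 1 / 2.
  by have /cvgr_lt := @continuous_l2norm R n x; exact.
by apply: filterS n2 => y y2; apply: xmax; rewrite inE; exact: ltW.
Qed.

Theorem theorem1p2 (R : realType) (Ca Cc : R) (Ca_gt0 : 0 < Ca)
    (Cc_gt0 : 0 < Cc) :
  exists C : nat -> R -> R,
  forall (n : nat) (u : 'rV[R]_n -> R)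
    (Theta : 'rV[R]_n -> R -> 'rV[R]_n -> R)
    (lambda : 'rV[R]_n -> 'I_n -> R),
  (0 < n)%N ->
  smooth_on (unit_ball n) u ->
  (forall x, unit_ball n x -> eigenvalues (hessian u x) (lambda x)) ->
  (forall x, unit_ball n x ->
    \sum_(i < n) atan (lambda x i) = Theta x (u x) (grad u x)) ->
  (forall x, unit_ball n x ->
    - (n%:R * (pi / 2)) < Theta x (u x) (grad u x) < n%:R * (pi / 2)) ->
  (forall x, unit_ball n x ->
    critical_phase R n <= `|Theta x (u x) (grad u x)|) ->
  (* differentiability of Theta, so that D_x, D_z and D_p are meaningful *)
  (forall w, Gamma1 u w ->
    differentiable
      (fun v : 'rV[R]_n * R * 'rV[R]_n => Theta v.1.1 v.1.2 v.2) w) ->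
  (* (a) *)
  (forall z p, (u @` unit_ball n) z -> (grad u @` unit_ball n) p ->
    Ck_on 2 (unit_ball n) (fun x => Theta x z p)) ->
  (Theta_xx_norm Theta u < +oo)%E ->
  (forall x z p, Gamma1 u (x, z, p) ->
    l2norm (D_x Theta x z p)
      <= Ca * Num.sqrt (Theta x z p - critical_phase R n)) ->
  (* (b) *)
  (forall x z p, Gamma1 u (x, z, p) -> 0 <= D_z Theta x z p) ->
  (* (c) *)
  (forall x z p, Gamma1 u (x, z, p) ->
    l2norm p * l2norm (D_p Theta x z p)
      <= Cc * (Theta x z p - critical_phase R n)) ->
  ((l2norm (grad u 0))%:E
    <= (C n (fine (Theta_xx_norm Theta u)))%:E
       * (1 + osc (unit_ball n) u ^+ 2))%E.
Proof.
pose K n : R := (n%:R ^+ 3 * (229 + 338 * Cc + 94 * Ca)) ^+ 2 + 9 * n%:R.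
(* The factor 2 comes from (1 + M)^2 <= 2 (1 + M^2), with M the oscillation of u. *)
exists (fun n _ => 2 * K n).
move=> n u Theta lambda n0 su eig eqn _ _ dTheta _ _ HDx HDz HDp.
have K0 : 0 < K n by rewrite ltr_wpDl ?sqr_ge0 // mulr_gt0 // ltr0n.
have K20 : 0 < 2 * K n by rewrite mulr_gt0.
(* When u is unbounded on the ball the oscillation, and with it the right side, is +oo. *)
have oscy : ((l2norm (grad u 0))%:E <= (2 * K n)%:E * (1 + +oo ^+ 2))%E.
  by rewrite expe2 mulyy addey // gt0_muley ?lte_fin // leey.
have b0 : unit_ball n (0 : 'rV[R]_n).
  by rewrite /unit_ball /= l2norm_rowE big1 ?sqrtr0 // => i _; rewrite mxE expr0n.
have sup_ge x : unit_ball n x ->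
    ((u x)%:E <= ereal_sup [set (u x)%:E | x in unit_ball n])%E.
  by move=> bx; apply: ereal_sup_ubound; exists x.
have inf_le x : unit_ball n x ->
    (ereal_inf [set (u x)%:E | x in unit_ball n] <= (u x)%:E)%E.
  by move=> bx; apply: ereal_inf_lbound; exists x.
rewrite /osc; move: sup_ge inf_le.
case: (ereal_sup _) => [s| |] sup_ge; last by have := sup_ge 0 b0; rewrite leeNy_eq.
- case: (ereal_inf _) => [b| |] inf_le.
  + pose M := s - b.
    have M0 : 0 <= M.
      rewrite subr_ge0 -lee_fin; exact: le_trans (inf_le 0 b0) (sup_ge 0 b0).
    (* Taking m = 1 + M rather than M ensures m >= 1, even for constant u. *)
    have m1 : 1 <= 1 + M by rewrite lerDl.
    have ubd x : unit_ball n x -> b <= u x <= b + (1 + M).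
      move=> bx; have := inf_le x bx; have := sup_ge x bx; rewrite !lee_fin /M.
      by move=> us bu; rewrite bu; lra.
    rewrite -EFinB -/M -EFin_expe -EFinD -EFinM lee_fin.
    apply: le_trans (gradient_bound_of_bounds n0 Ca_gt0 Cc_gt0 m1 su eig eqn
      dTheta HDx HDz HDp ubd) _.
    rewrite -/(K n) [2 * K n]mulrC -mulrA ler_pM2l //.
    by have := sqr_ge0 (1 - M); lra.
  + by have := inf_le 0 b0; rewrite leye_eq.
  + exact: oscy.
- case: (ereal_inf _) => [b| |] inf_le.
  + exact: oscy.
  + by have := inf_le 0 b0; rewrite leye_eq.
  + exact: oscy.
Qed.
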